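(* Let $C$ be an irreducible cubic algebraic curve in the complex projective plane $\mathbb{P}^2$, and let $(a_{i1}:a_{i2}:a_{i3})$, $i=1,\ldots,9$, be $9$ distinct points in the abelian group of non-singular points of $C$ such that their sum is not a torsion element and the $9\times 3$ matrix $(a_{ij})_{i=1,\ldots,9}^{j=1,2,3}$ has rank $3$. Let \[ G_1=\Big\{s=(s_1,\ldots,s_9)\in\mathbb{C}^9 \;\Big|\; \sum_{i=1}^9 s_ia_{ij}=0,\ j=1,2,3\Big\},\qquad T=\Big\{t=(t_1,\ldots,t_9)\in(\mathbb{C}^\times)^9\;\Big|\;\prod_{i=1}^9t_i=1\Big\}, \] and let $G=G_1\times T$ act on the polynomial algebra $S=\mathbb{C}[x_1,\ldots,x_9,y_1,\ldots,y_9]$ by $\mathbb{C}$-algebra automorphisms via \[ (s,t)\cdot x_i=t_ix_i,\qquad (s,t)\cdot y_i=t_i(s_ix_i+y_i),\qquad i=1,\ldots,9. \] Then the Hilbert series of the algebra $S^G$ of invariants (graded by the usual total degree) is \[ H(S^G,q)=\frac{1+4q^9+7q^{18}+10q^{27}+10q^{36}+4q^{45}}{(1-q^{18})^4}. \] In particular, $H(S^G,q)$ is a nice rational function.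
   Context: The set of non-singular points of $C$ carries its well-known abelian group structure, with an inflection point as zero element (so that three non-singular points of $C$, counted with multiplicity, sum to zero exactly when they form the intersection of $C$ with a line). $G_1$ is a subgroup of the additive group $\mathbb{C}^9$ and $T$ is a subgroup of the multiplicative group $(\mathbb{C}^\times)^9$. $S$ is graded with all $x_i,y_i$ of degree $1$, and $H(S^G,q)=\sum_{d\ge0}\dim_{\mathbb{C}}((S^G)_d)q^d$, where $(S^G)_d$ is the degree $d$ homogeneous component of $S^G$. A power series in $\mathbb{Z}[[q]]$ is a nice rational function if it is of the form $P(q)/\prod_{j}(1-q^{d_j})$ with $P\in\mathbb{Z}[q]$ and a finite product over positive integers $d_j$. *)

(* Defs.v *)
From HB Require Import structures.
From mathcomp Require Export all_boot all_order all_algebra.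
From mathcomp Require Export boolp classical_sets reals complex mpoly.

Set Implicit Arguments.
Unset Strict Implicit.
Unset Printing Implicit Defensive.

Import GRing.Theory.
Local Open Scope ring_scope.
Local Open Scope classical_set_scope.

Section PlaneCubics.
Variable F : closedFieldType.

(* A point of P^2 is given by a non-zero row vector of homogeneous
   coordinates; two such vectors represent the same point iff they have the
   same row space, i.e., iff (P == Q)%MS. *)
Implicit Types (f : {mpoly F[3]}) (P Q S O : 'rV[F]_3).

Definition irreducible_mpoly n (f : {mpoly F[n]}) : Prop :=
  f \isn't a GRing.unit /\
  (forall g h : {mpoly F[n]},
     f = g * h -> (g \is a GRing.unit) || (h \is a GRing.unit)).

(* f is an equation of an irreducible plane cubic curve *)
Definition irreducible_cubic f : Prop :=
  f \is 3.-homog /\ irreducible_mpoly f.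

Definition nonsingular_point f P : Prop :=
  [/\ P != 0, f.@[P 0] = 0 & exists i : 'I_3, (f^`M(i)).@[P 0] != 0].

(* P, Q, S are, with multiplicity, the intersection of the curve f = 0 with a
   line.  The line is parametrized by the rows of B; in the coordinates x of
   this parametrization f restricts to a non-zero binary cubic form, which is
   required to be, up to a constant, the product of the linear forms
   \det (col_mx x p), \det (col_mx x q), \det (col_mx x s) whose zeros are the
   coordinates p, q, s of P, Q, S. *)
Definition line_section f P Q S : Prop :=
  exists B : 'M[F]_(2, 3), exists p q s : 'rV[F]_2, exists c : F,
    [/\ \rank B = 2%N, [/\ p *m B = P, q *m B = Q & s *m B = S], c != 0 &
        forall x : 'rV[F]_2,
          f.@[(x *m B) 0] = c * (\det (col_mx x p : 'M_2) *
                                 \det (col_mx x q : 'M_2) *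
                                 \det (col_mx x s : 'M_2))].

Definition inflection_point f O : Prop :=
  nonsingular_point f O /\ line_section f O O O.

(* The third intersection point with the curve of the line through P and Q
   (the tangent line if P = Q).  It is unique as a point of P^2; a
   representative is chosen.  The default value 0 is not reached when P and Q
   are non-singular points of an irreducible cubic. *)
Definition third_point f P Q : 'rV[F]_3 :=
  xget 0 [set S | nonsingular_point f S /\ line_section f P Q S].

(* The group law with the inflection point O as zero element: P, Q and
   R = third_point f P Q sum to zero, and so do O, R and - R. *)
Definition cubic_add f O P Q : 'rV[F]_3 :=
  third_point f O (third_point f P Q).

Definition cubic_sum f O n (a : 'I_n -> 'rV[F]_3) : 'rV[F]_3 :=
  \big[cubic_add f O / O]_(i < n) a i.

Definition cubic_mul f O (n : nat) P : 'rV[F]_3 := iter n (cubic_add f O P) O.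

Definition cubic_torsion f O P : Prop :=
  exists2 n : nat, (0 < n)%N & (cubic_mul f O n P == O)%MS.

End PlaneCubics.

Section Subspaces.
Variables (F : fieldType) (V : vectType F).

Lemma vspace_of_submod (A : set V) :
  A 0 -> (forall c u v, A u -> A v -> A (c *: u + v)) ->
  exists U : {vspace V}, forall v, v \in U <-> A v.
Proof.
move=> A0 Alin.
pose ok n := `[< exists2 U : {vspace V}, \dim U = n & forall v, v \in U -> A v >].
have ex_ok : exists n, ok n.
  exists 0%N; apply/asboolP; exists 0%VS; first exact: dimv0.
  by move=> v; rewrite memv0 => /eqP ->.
have ub n : ok n -> (n <= \dim (fullv : {vspace V}))%N.
  by move=> /asboolP[U <- _]; apply/dimvS/subvf.
case: (ex_maxnP ex_ok ub) => n /asboolP[U dimU sUA] maxn.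
exists U => v; split=> [|Av]; first exact: sUA.
apply: contrapT => /negP vU.
have sUvA w : w \in (<[v]> + U)%VS -> A w.
  move=> /memv_addP[x /vlineP[c ->] [y yU ->]].
  exact/Alin/sUA.
have /maxn : ok (\dim (<[v]> + U)%VS) by apply/asboolP; exists (<[v]> + U)%VS.
rewrite -dimU leqNgt => /negP; apply.
rewrite ltn_neqAle dimvS ?addvSr // andbT; apply: contra vU => /eqP eqd.
have /eqP -> : U == (<[v]> + U)%VS by rewrite eqEdim addvSr eqd leqnn.
by rewrite memvE addvSl.
Qed.

End Subspaces.

Section Invariants.
Variable F : closedFieldType.

Definition G1 (a : 'M[F]_(9, 3)) : set 'rV[F]_9 := [set s | s *m a = 0].

Definition T : set 'rV[F]_9 :=
  [set t | (forall i, t 0 i != 0) /\ \prod_i t 0 i = 1].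

Definition G (a : 'M[F]_(9, 3)) : set ('rV[F]_9 * 'rV[F]_9) := G1 a `*` T.

Definition xvar (i : 'I_9) : {mpoly F[9 + 9]} := 'X_(lshift 9 i).
Definition yvar (i : 'I_9) : {mpoly F[9 + 9]} := 'X_(rshift 9 i).

Definition act_var (s t : 'rV[F]_9) (k : 'I_(9 + 9)) : {mpoly F[9 + 9]} :=
  match split k with
  | inl i => t 0 i *: xvar i
  | inr i => t 0 i *: (s 0 i *: xvar i + yvar i)
  end.

Definition act (g : 'rV[F]_9 * 'rV[F]_9) (p : {mpoly F[9 + 9]}) :
    {mpoly F[9 + 9]} :=
  p \mPo [tuple act_var g.1 g.2 k | k < 9 + 9].

Definition invariant (H : set ('rV[F]_9 * 'rV[F]_9)) (p : {mpoly F[9 + 9]}) :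
    Prop :=
  forall g, H g -> act g p = p.

Lemma homog_invariants_subspace H d :
  exists U : {vspace dhomog (9 + 9) F d},
    forall p, p \in U <-> invariant H (mpoly_of_dhomog p).
Proof.
apply: (@vspace_of_submod F (dhomog (9 + 9) F d)
          (fun p => invariant H (mpoly_of_dhomog p))) => [g _|c u v Hu Hv g Hg].
  exact: linear0.
rewrite /act; transitivity (c *: act g u + act g v); first exact: linearP.
by rewrite Hu // Hv.
Qed.

Definition homog_invariants H d : {vspace dhomog (9 + 9) F d} :=
  projT1 (cid (homog_invariants_subspace H d)).

Definition hilbert_series H (d : nat) : int := (\dim (homog_invariants H d))%:Z.

End Invariants.

(* A power series in Z[[q]] is given by its coefficients h : nat -> int.  For a
   denominator D with constant term 1, h is the expansion of N / D iff
   D * h = N in Z[[q]]. *)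
Definition series_quotient (h : nat -> int) (N D : {poly int}) : Prop :=
  D`_0 = 1 /\ (forall n, \sum_(i < n.+1) D`_i * h (n - i)%N = N`_n).

Definition nice_rational (h : nat -> int) : Prop :=
  exists (N : {poly int}) (ds : seq nat),
    all (fun d => 0 < d)%N ds /\
    series_quotient h N (\prod_(d <- ds) (1 - 'X^d)).

(* Main.v *)
From HB Require Import structures.
Require Import Defs.
From mathcomp Require Import ring zify.

Set Implicit Arguments.
Unset Strict Implicit.
Unset Printing Implicit Defensive.

Import GRing.Theory.
Local Open Scope ring_scope.

(** Invariance under the torus [T] means that every monomial of an invariant has
    the same degree [w] in each of the nine pairs [x_i], [y_i]; so invariants live
    in the degrees [9 w] ([homog_invariant_weight]).  Setting all [x_i] to [1]
    turns such an invariant into a polynomial [Q] of degree at most [w] in each of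
    nine variables [z_i], and invariance under [G1] means that [Q] is constant on
    the cosets of the kernel of [z |-> z a], i.e., that [Q(z) = P(z a)] for a
    polynomial [P] in three variables.  Conversely the product of all [x_i ^ w]
    with [Q(y_i / x_i)] is a polynomial as soon as [Q] has degree at most [w] in
    each variable.  The degree of [P(z a)] in [z_i] is read off at the [i]-th
    point: for a form [P] of degree [d] it is at most [w] exactly when [P]
    has multiplicity at least [d - w] at the [i]-th row of [a].  Hence the
    dimension in degree [9 w] is the sum over [d] of the dimensions of the spaces
    of plane curves of degree [d] with multiplicity [d - w] at the nine points
    ([dim_homog_invariants]).

    It remains to know the dimension of the space [V(d, k)] of forms of degree [d]
    with multiplicity [k] at the nine points ([dim_vanishing]).  It is [0] when
    [d < 3 k], and for [d = 3 k + e] the nine points impose independent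
    conditions.  That the dimension is at least as large is a count of
    conditions ([mult_lower_bound]).  For the converse, restrict to the cubic
    ([vanishing_upper]).  The forms vanishing on the cubic are [f] times elements
    of [V(d - 3, k - 1)], because [f] has multiplicity one at its nonsingular
    points.  The restrictions of the others form a space of dimension at most
    [3 e] ([cut_upper_bound]): restricting to a line that avoids the nine points
    costs three dimensions for each degree, and in degree [3 k] nothing is left,
    since a form of degree [3 k] that cuts out [k] times the nine points on the
    cubic would make their sum a torsion point ([torsion_multiple]).

    The last fact is half of Abel's theorem ([realized_torsion]), obtained from
    chords alone: a form with the points [P] and [Q] in its divisor is
    multiplied by the line through [O] and the third point [R] of the line [PQ],
    and divided by the line [PQ]; this replaces [P] and [Q] by [O] and [P + Q].
    In the end only [O] and the [k]-fold sum are left, and dividing by the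
    inflectional tangent at [O] reduces the degree to one, where the claim is
    clear.  The divisions are instances of Max Noether's theorem for a line
    ([noether]).  The curve may be singular elsewhere, so divisors are
    lists of nonsingular points, and orders are measured on parametrized branches
    truncated at a high power of the parameter ([branch]); [contact] compares the
    order of a line on a branch with the multiplicity of the zero of [f] on the
    line.

    Summing up, the dimension in degree [9 w] is a cubic polynomial in [w./2] on
    each parity class of [w], and the generating function is the stated one
    ([series_quotient_count]). *)

(** * Polynomial identities and evaluation along arcs *)

Lemma mpoly_rmorph_ext (R : comNzRingType) (S : comNzRingType) n
    (phi psi : {rmorphism {mpoly R[n]} -> S}) :
  (forall c, phi c%:MP = psi c%:MP) -> (forall i, phi 'X_i = psi 'X_i) ->
  phi =1 psi.
Proof.
move=> eC eX p; rewrite [p]mpolyE !rmorph_sum; apply: eq_bigr => m _.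
rewrite -mul_mpolyC !rmorphM eC mpolyXE_id !rmorph_prod; congr (_ * _).
by apply: eq_bigr => i _; rewrite !rmorphXn eX.
Qed.

Section LastVariable.
Variable n : nat.
Implicit Types (m : 'X_{1..n}) (mu : 'X_{1..n.+1}).

Let widen := widen_ord (leqnSn n).

Lemma ord_lastP (i : 'I_n.+1) : {j : 'I_n | i = widen j} + {i = ord_max}.
Proof.
have [lti|lei] := ltnP i n; first by left; exists (Ordinal lti); apply/val_inj.
by right; apply/val_inj/eqP; rewrite eqn_leq lei -ltnS ltn_ord.
Qed.

Definition mbelast mu : 'X_{1..n} := [multinom mu (widen i) | i < n].

Definition mrcons m k : 'X_{1..n.+1} := [multinom of rcons m k].

Lemma mrcons_max m k : mrcons m k ord_max = k.
Proof. by rewrite /mrcons (mnm_nth 0%N) /= nth_rcons size_tuple ltnn eqxx. Qed.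

Lemma mrcons_widen m k i : mrcons m k (widen i) = m i.
Proof.
by rewrite /mrcons (mnm_nth 0%N) /= nth_rcons size_tuple ltn_ord -mnm_nth.
Qed.

Lemma mrconsK mu : mrcons (mbelast mu) (mu ord_max) = mu.
Proof.
apply/mnmP => i; case: (ord_lastP i) => [[j ->]|->].
  by rewrite mrcons_widen mnmE.
by rewrite mrcons_max.
Qed.

Lemma mcoeff_muni (R : comNzRingType) (p : {mpoly R[n.+1]}) k m :
  ((muni p)`_k)@_m = p@_(mrcons m k).
Proof.
have rconsE mu : (mbelast mu == m) && (k == mu ord_max) = (mu == mrcons m k).
  apply/andP/eqP => [[/eqP <- /eqP ->]|->]; first by rewrite mrconsK.
  rewrite mrcons_max eqxx; split=> //.
  by apply/eqP/mnmP => i; rewrite mnmE mrcons_widen.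
rewrite muniE coef_sum raddf_sum /=.
rewrite (eq_bigr (fun mu => p@_mu * (mu == mrcons m k)%:R)).
  have [mp|mp] := boolP (mrcons m k \in msupp p).
    rewrite (bigD1_seq (mrcons m k)) ?msupp_uniq //= eqxx mulr1.
    by rewrite big1 ?addr0 // => mu /negPf ->; rewrite mulr0.
  rewrite memN_msupp_eq0 // big_seq big1 // => mu mup.
  by case: eqP => [e|]; [rewrite -e mup in mp | rewrite mulr0].
move=> mu _; rewrite -rconsE !coefZ coefXn mulr_natr.
rewrite raddfMn /= mcoeffZ mcoeffX -[_ *+ (k == _)]mulr_natr.
by rewrite -mulrA -natrM mulnb.
Qed.

End LastVariable.

(** At every point of the first [n] coordinates, the polynomial in the last one
    has infinitely many roots, so that its coefficients vanish there. *)
Lemma mpoly_eq0_eval (F : closedFieldType) n (p : {mpoly F[n]}) :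
  (forall v, p.@[v] = 0) -> p = 0.
Proof.
elim: n p => [|n IHn] p p0.
  by rewrite [p]nvar0_mpolyC; have := p0 (fun=> 0); rewrite [p in p.@[_]]nvar0_mpolyC mevalC => ->.
suff mp0 : muni p = 0.
  by apply/mpolyP => m; rewrite -[m]mrconsK -mcoeff_muni mp0 coef0 !mcoeff0.
apply/polyP => k; rewrite coef0; apply: IHn => v.
rewrite -[LHS](coef_map (meval v)); suff -> : map_poly (meval v) (muni p) = 0 by rewrite coef0.
apply: contraTeq isT => /closed_nonrootP[x] /rootP[].
pose w i := match split (cast_ord (esym (addn1 n)) i) with inl j => v j | inr _ => x end.
rewrite -(p0 w).
apply: (mpoly_rmorph_ext (phi := horner_eval x \o map_poly (meval v) \o @muni n F)
  (psi := meval w)) => [c|i] /=; rewrite /horner_eval.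
  by rewrite muniC map_polyC hornerC /= !mevalC.
rewrite mevalXU /muni mmapX mmap1U /w; case: split => j /=.
  by rewrite map_polyC hornerC /= mevalXU.
by rewrite map_polyX hornerX.
Qed.

Lemma mpoly_eq_eval (F : closedFieldType) n (p q : {mpoly F[n]}) :
  (forall v : 'rV[F]_n, p.@[v 0] = q.@[v 0]) -> p = q.
Proof.
move=> pq; apply/eqP; rewrite -subr_eq0; apply/eqP/mpoly_eq0_eval => v.
rewrite -(@meval_eq _ _ ((\row_i v i) 0)) => [|i]; last by rewrite mxE.
by rewrite mevalB pq subrr.
Qed.

Lemma poly_eq0_eval (F : closedFieldType) (p : {poly F}) :
  (forall x, x != 0 -> p.[x] = 0) -> p = 0.
Proof.
move=> p0; have /eqP : 'X * p = 0.
  apply: contraTeq isT => /closed_nonrootP[x] /rootP[].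
  by rewrite hornerM hornerX; have [->|/p0->] := eqVneq x 0; rewrite ?mul0r ?mulr0.
by rewrite mulf_eq0 polyX_eq0 => /eqP.
Qed.

Section Evaluation.
Variable F : fieldType.

(** The restriction of [p] to the parametrized curve [g]. *)
Definition pev n (g : 'rV[{poly F}]_n) (p : {mpoly F[n]}) : {poly F} :=
  mmap polyC (g 0) p.

HB.instance Definition _ n (g : 'rV[{poly F}]_n) :=
  GRing.RMorphism.copy (pev g) (mmap polyC (g 0)).

Lemma pevC n (g : 'rV[{poly F}]_n) c : pev g c%:MP = c%:P.
Proof. exact: mmapC. Qed.

Lemma pevX n (g : 'rV[{poly F}]_n) i : pev g 'X_i = g 0 i.
Proof. by rewrite /pev mmapX mmap1U. Qed.

Lemma pevXm n (g : 'rV[{poly F}]_n) m : pev g 'X_[m] = \prod_i g 0 i ^+ m i.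
Proof. by rewrite /pev mmapX. Qed.

Lemma pevZ n (g : 'rV[{poly F}]_n) c p : pev g (c *: p) = c%:P * pev g p.
Proof. by rewrite /pev mmapZ. Qed.

Lemma pev_horner n (g : 'rV[{poly F}]_n) p x :
  (pev g p).[x] = p.@[(map_mx (horner_eval x) g) 0].
Proof.
apply: (mpoly_rmorph_ext (phi := horner_eval x \o pev g)
  (psi := meval (map_mx (horner_eval x) g 0))) => [c|i] /=.
  by rewrite pevC mevalC /horner_eval hornerC.
by rewrite pevX mevalXU mxE.
Qed.

Lemma pev_const n (v : 'rV[F]_n) p : pev (map_mx polyC v) p = (p.@[v 0])%:P.
Proof.
apply: (mpoly_rmorph_ext (phi := pev (map_mx polyC v))
  (psi := polyC \o meval (v 0))) => [c|i] /=; first by rewrite pevC mevalC.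
by rewrite pevX mevalXU mxE.
Qed.

Lemma pev_comp n k (g : 'rV[{poly F}]_k) (lq : n.-tuple {mpoly F[k]}) p :
  pev g (p \mPo lq) = pev (\row_i pev g (tnth lq i)) p.
Proof.
apply: (mpoly_rmorph_ext (phi := pev g \o comp_mpoly lq)
  (psi := pev (\row_i pev g (tnth lq i)))) => [c|i] /=.
  by rewrite comp_mpolyC !pevC.
by rewrite comp_mpolyXU pevX mxE (tnth_nth 0).
Qed.

(** Linear changes of variables: [p \mPo lforms M] is the polynomial function
    [v |-> p (v *m M)]. *)
Definition lforms m n (M : 'M[F]_(m, n)) : n.-tuple {mpoly F[m]} :=
  [tuple \sum_j M j i *: 'X_j | i < n].

Lemma pev_lforms m n (M : 'M[F]_(m, n)) g p :
  pev g (p \mPo lforms M) = pev (g *m map_mx polyC M) p.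
Proof.
rewrite pev_comp; congr (pev _ p); apply/rowP => i.
rewrite !mxE tnth_mktuple rmorph_sum; apply: eq_bigr => j _.
by rewrite /= pevZ pevX mxE mulrC.
Qed.

Lemma meval_lforms m n (M : 'M[F]_(m, n)) (v : 'rV_m) p :
  (p \mPo lforms M).@[v 0] = p.@[(v *m M) 0].
Proof. by apply: polyC_inj; rewrite -!pev_const pev_lforms map_mxM. Qed.

Definition lform n (a : 'cV[F]_n) : {mpoly F[n]} := tnth (lforms a) 0.

Lemma lformE n (a : 'cV[F]_n) : lform a = 'X_0 \mPo lforms a.
Proof. by rewrite comp_mpolyXU /lform (tnth_nth 0). Qed.

Lemma pev_lform n (a : 'cV[F]_n) g :
  pev g (lform a) = (g *m map_mx polyC a) 0 0.
Proof. by rewrite lformE pev_lforms pevX. Qed.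

Lemma meval_lform n (a : 'cV[F]_n) (v : 'rV_n) :
  (lform a).@[v 0] = (v *m a) 0 0.
Proof. by rewrite lformE meval_lforms mevalXU. Qed.

Lemma dhomog_lforms m n (M : 'M[F]_(m, n)) d p :
  p \is d.-homog -> p \mPo lforms M \is d.-homog.
Proof.
have hX mu : 'X_[mu] \mPo lforms M \is (mdeg mu).-homog.
  rewrite comp_mpolyX mdegE; elim/big_rec2 : _ => [|i e q _ hq].
    exact: dhomog1.
  apply: dhomogM => //; rewrite -[X in X.-homog]mul1n; apply: dhomogMn.
  rewrite tnth_mktuple; apply: rpred_sum => j _; apply: rpredZ.
  by rewrite dhomogX; apply/eqP/mdeg1.
move=> /dhomogP hp; rewrite comp_mpolyEX big_seq rpred_sum // => mu /hp <-.
exact/rpredZ/hX.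
Qed.

Lemma dhomog_lform n (a : 'cV[F]_n) : lform a \is 1.-homog.
Proof. by rewrite lformE; apply: dhomog_lforms; rewrite dhomogX; apply/eqP/mdeg1. Qed.

Lemma pev_homog_scale n d (p : {mpoly F[n]}) c g :
  p \is d.-homog -> pev (c *: g) p = c ^+ d * pev g p.
Proof.
move=> /dhomogP hp; rewrite [p]mpolyE !rmorph_sum mulr_sumr.
apply: eq_big_seq => mu /hp <-; rewrite /= !pevZ mulrCA !pevXm mdegE; congr (_ * _).
rewrite -prodrXr -big_split; apply: eq_bigr => i _.
by rewrite /= mxE exprMn.
Qed.

Lemma meval_homog_scale n d (p : {mpoly F[n]}) c (v : 'rV_n) :
  p \is d.-homog -> p.@[(c *: v) 0] = c ^+ d * p.@[v 0].
Proof.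
move=> hp; apply: polyC_inj; rewrite rmorphM rmorphXn /= -!pev_const.
by rewrite -(pev_homog_scale _ _ hp) map_mxZ.
Qed.

Definition dirder n (p : {mpoly F[n]}) (g h : 'rV[{poly F}]_n) : {poly F} :=
  \sum_i h 0 i * pev g p^`M(i).

(** The expansion is stable under sums and products, and holds for variables. *)
Lemma pev_taylor n (p : {mpoly F[n]}) g h s :
  exists r, pev (g + s *: h) p = pev g p + s * dirder p g h + s ^+ 2 * r.
Proof.
rewrite /dirder; elim/mpolyind: p => [|c m p _ _ [r IH]].
  exists 0; rewrite !rmorph0 big1 => [|i _]; last by rewrite mderiv0 rmorph0 mulr0.
  by rewrite !mulr0 !addr0.
pose P q := exists r, pev (g + s *: h) q =
  pev g q + s * (\sum_i h 0 i * pev g q^`M(i)) + s ^+ 2 * r.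
have PD q q' : P q -> P q' -> P (q + q').
  move=> [t e] [t' e']; exists (t + t'); rewrite !rmorphD /= e e'.
  under [in RHS]eq_bigr do rewrite mderivD rmorphD /= mulrDr.
  rewrite big_split /= !mulrDr; ring.
have PM q q' : P q -> P q' -> P (q * q').
  move=> [t e] [t' e'].
  pose D q := \sum_i h 0 i * pev g q^`M(i).
  rewrite -!/(D _) in e e'.
  exists (D q * D q' + t * pev g q' + pev g q * t' + s * (D q * t' + t * D q') + s ^+ 2 * t * t').
  rewrite !rmorphM /= e e'.
  have -> : \sum_i h 0 i * pev g (q * q')^`M(i) = D q * pev g q' + pev g q * D q'.
    rewrite /D mulr_suml mulr_sumr -big_split; apply: eq_bigr => i _.
    rewrite /= mderivM rmorphD !rmorphM /=; ring.
  ring.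
have PC a : P a%:MP.
  exists 0; rewrite !pevC big1 => [|i _]; last by rewrite mderivC rmorph0 mulr0.
  by rewrite !mulr0 !addr0.
apply: PD; last by exists r.
rewrite -mul_mpolyC mpolyXE_id; apply: (PM) => //.
apply: (big_ind P) => [|q q'|i _]; [by rewrite -mpolyC1 | exact: PM |].
elim: (m i) => [|k IHk]; first by rewrite expr0 -mpolyC1.
rewrite exprS; apply: (PM) => //; exists 0; rewrite !pevX !mxE mulr0 addr0.
rewrite (bigD1 i) //= big1 => [|j ji]; last first.
  by rewrite mderivX mnm1E eq_sym (negPf ji) scale0r rmorph0 mulr0.
by rewrite mderivX mnm1E eqxx scale1r -[X in (X - _)%MM]add0m addmK mpolyX0 rmorph1 mulr1 addr0.
Qed.

End Evaluation.

Section Homogeneous.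
Variables (F : fieldType) (n : nat).
Implicit Types p q : {mpoly F[n]}.

Lemma pihomogM e k q p : q \is e.-homog -> (e <= k)%N ->
  pihomog mdeg k (q * p) = q * pihomog mdeg (k - e) p.
Proof.
move=> hq ek; rewrite [p]mpolyE mulr_sumr !raddf_sum /= mulr_sumr.
apply: eq_bigr => m _; rewrite -scalerAr !linearZ /= -scalerAr; congr (_ *: _).
have hqX : q * 'X_[m] \is (e + mdeg m).-homog by rewrite dhomogM ?dhomogX.
rewrite pihomogX; case: eqP => [em|ne].
  by rewrite pihomog_dE //; rewrite [mdeg m]em subnKC in hqX.
rewrite mulr0 (pihomog_ne0 (d := (e + mdeg m)%N)) //; apply/eqP => ke.
by apply: ne; rewrite -ke; exact/esym/addKn.
Qed.

Lemma pihomogM_small e k q p : q \is e.-homog -> (k < e)%N ->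
  pihomog mdeg k (q * p) = 0.
Proof.
move=> hq ke; rewrite [p]mpolyE mulr_sumr raddf_sum /= big1 // => m _.
rewrite -scalerAr linearZ /= (pihomog_ne0 (d := (e + mdeg m)%N)) ?scaler0 //.
  by apply/eqP => e1; move: ke; rewrite -e1 ltnNge leq_addr.
by rewrite dhomogM ?dhomogX.
Qed.

End Homogeneous.

Section LinearForms.
Variable (F : closedFieldType).

Lemma complete_col n (a : 'cV[F]_n.+1) : a != 0 ->
  exists2 A : 'M[F]_n.+1, A \in unitmx & col 0 A = a.
Proof.
move=> a0; have ra : \rank a^T = 1%N by apply/eqP; rewrite rank_rV -trmx0 (inj_eq trmx_inj) a0.
exists ((col_ebase a^T) 0 0 *: row_ebase a^T)^T.
  rewrite unitmx_tr -mul_scalar_mx unitmx_mul row_ebase_unit andbT.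
  have := col_ebase_unit a^T; rewrite !unitmxE det_mx11 det_scalar !unitfE.
  exact: expf_neq0.
apply: trmx_inj; rewrite tr_col trmxK -[RHS]mulmx_ebase ra.
rewrite linearZ /= {2}[col_ebase _]mx11_scalar mul_scalar_mx -scalemxAl rowE.
congr (_ *: (_ *m _)); apply/rowP => j; rewrite !mxE /= eq_sym.
by case: j => [[|j] lj]; rewrite -?val_eqE.
Qed.

(** The part of [p] that is free of the [k]-th variable agrees with [p] on the
    hyperplane and is constant along the [k]-th axis, so it vanishes. *)
Lemma mpoly_dvd_var n (p : {mpoly F[n]}) k :
  (forall v, v k = 0 -> p.@[v] = 0) -> exists q, p = 'X_k * q.
Proof.
move=> p0.
pose r := \sum_(m <- msupp p | m k == 0%N) p@_m *: 'X_[m].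
pose q := \sum_(m <- msupp p | m k != 0%N) p@_m *: 'X_[m - U_(k)].
have pE : p = r + 'X_k * q.
  rewrite {1}[p]mpolyE (bigID (fun m : 'X_{1..n} => m k == 0%N)) /=; congr (_ + _).
  rewrite mulr_sumr; apply: eq_bigr => m mk.
  by rewrite -scalerAr -mpolyXD addmC submK // lep1mP.
exists q; rewrite {1}pE (_ : r = 0) ?add0r //; apply: mpoly_eq0_eval => v.
pose v' i := if i == k then 0 else v i.
have /p0 : v' k = 0 by rewrite /v' eqxx.
rewrite pE mevalD mevalM mevalXU {2}/v' eqxx mul0r addr0 => <-.
rewrite !raddf_sum /=; apply: eq_bigr => m /eqP mk; rewrite !mevalZ !mevalX.
congr (_ * _); apply: eq_bigr => i _; rewrite /v'.
by case: eqP => // ->; rewrite mk !expr0.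
Qed.

(** A linear change of coordinates turns the linear form into a variable. *)
Lemma lform_dvd n (a : 'cV[F]_n) (p : {mpoly F[n]}) : a != 0 ->
  (forall v : 'rV_n, v *m a = 0 -> p.@[v 0] = 0) -> exists q, p = lform a * q.
Proof.
case: n a p => [|n] a p; first by rewrite flatmx0 eqxx.
move=> /complete_col[A Au <-] p0.
have [|q eq] := @mpoly_dvd_var _ (p \mPo lforms (invmx A)) 0.
  move=> v v0; rewrite -(@meval_eq _ _ ((\row_i v i) 0)) => [|i]; last by rewrite mxE.
  rewrite meval_lforms p0 //; apply/matrixP => i j; rewrite !ord1.
  have -> : col 0 A = A *m delta_mx 0 0 by rewrite colE.
  rewrite mulmxA mulmxKV //; rewrite mxE (bigD1 0) //= big1 => [|k k0].
    by rewrite !mxE v0 mul0r addr0.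
  by rewrite !mxE (negPf k0) mulr0.
exists (q \mPo lforms A).
have := congr1 (comp_mpoly (lforms A)) eq; rewrite rmorphM /=.
have -> : ('X_0 : {mpoly F[n.+1]}) \mPo lforms A = lform (col 0 A).
  rewrite comp_mpolyXU -tnth_nth /lform !tnth_mktuple.
  by apply: eq_bigr => j _; rewrite mxE.
move=> <-; apply: mpoly_eq_eval => v.
by rewrite !meval_lforms -mulmxA mulmxV // mulmx1.
Qed.

End LinearForms.

(** * Orders of vanishing along arcs *)

Section Order.
Variable F : fieldType.
Implicit Types (p q s : {poly F}).

Lemma dvdX_horner p : ('X %| p) = (p.[0] == 0).
Proof. by rewrite -['X]subr0 -polyC0 dvdp_XsubCl. Qed.

Lemma dvdXn_coef r p : reflect (forall j, (j < r)%N -> p`_j = 0) ('X^r %| p).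
Proof.
apply: (iffP idP) => [/dvdpP[q ->] j jr|h]; first by rewrite coefMXn jr.
rewrite -[p](poly_take_drop r) (_ : take_poly r p = 0) ?add0r ?dvdp_mull //.
by apply/polyP => j; rewrite coef_take_poly coef0; case: ifP => // /h.
Qed.

(** The order of vanishing at [0] is exactly [r], so that [p] is not zero. *)
Definition ord0 p r := exists2 u : {poly F}, u.[0] != 0 & p = 'X^r * u.

Lemma ord0_dvd p r : ord0 p r -> 'X^r %| p.
Proof. by case=> u _ ->; rewrite dvdp_mulr. Qed.

Lemma ord0M p q r r' : ord0 p r -> ord0 q r' -> ord0 (p * q) (r + r').
Proof.
move=> [u u0 ->] [v v0 ->]; exists (u * v); last by rewrite exprD; ring.
by rewrite hornerM mulf_neq0.
Qed.

Lemma ord0_unit p : p.[0] != 0 -> ord0 p 0.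
Proof. by move=> p0; exists p; rewrite ?expr0 ?mul1r. Qed.

Lemma coprimeXn p r : p.[0] != 0 -> coprimep ('X^r) p.
Proof.
move=> p0; apply: coprimep_expl; by rewrite coprimep_sym coprimepX.
Qed.

Lemma ord0_cancel p q r m : ord0 p r -> 'X^(r + m) %| p * q -> 'X^m %| q.
Proof.
move=> [u u0 ->]; rewrite exprD -mulrA dvdp_mul2l ?expf_neq0 ?polyX_eq0 //.
by rewrite Gauss_dvdpr // coprimeXn.
Qed.

(** Congruence modulo a higher power of [t] preserves the order. *)
Lemma ord0_congr p q r m : (r < m)%N -> ord0 p r -> 'X^m %| q - p -> ord0 q r.
Proof.
move=> rm [u u0 ->] /dvdpP[w]; rewrite -(subnKC rm) addSnnS exprD => /eqP.
rewrite subr_eq => /eqP ->; exists (w * 'X^((m - r.+1).+1) + u); last by ring.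
by rewrite !hornerE expr0n /= mulr0 add0r.
Qed.

Lemma ord0_divr p q r : ord0 (p * q) r -> q.[0] != 0 -> ord0 p r.
Proof.
move=> [u u0 e] q0; have : 'X^r %| p * q by rewrite e dvdp_mulr.
rewrite Gauss_dvdpl ?coprimeXn // => /dvdpP[w pE].
exists w; last by rewrite mulrC.
apply: contra_neq u0 => w0; suff -> : u = w * q by rewrite hornerM w0 mul0r.
by apply: (@mulfI _ 'X^r); rewrite ?expf_neq0 ?polyX_eq0 // -e pE; ring.
Qed.

Lemma ord0_max p r m : ord0 p r -> 'X^m %| p -> (m <= r)%N.
Proof.
move=> [u u0 ->] d; rewrite leqNgt; apply: contra u0 => rm.
move: d; rewrite -(subnKC rm) addSnnS exprD dvdp_mul2l ?expf_neq0 ?polyX_eq0 //.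
by rewrite exprS => /(dvdp_trans (dvdp_mulr _ (dvdpp _))); rewrite dvdX_horner.
Qed.
End Order.

Section Arcs.
Variables (F : fieldType) (n : nat).
Implicit Types (p : {mpoly F[n]}) (X v : 'rV[F]_n) (dl : 'rV[{poly F}]_n).

Definition at0 dl : 'rV[F]_n := map_mx (horner_eval 0) dl.

(** Every parametrized curve through [X] at [t = 0] has this form. *)
Definition arc X dl : 'rV[{poly F}]_n := map_mx polyC X + 'X *: dl.

Definition grad p X : 'cV[F]_n := \col_i (p^`M(i)).@[X 0].

Lemma at0_arc X dl : at0 (arc X dl) = X.
Proof. by apply/rowP => i; rewrite !mxE /horner_eval !hornerE ?mul0r ?addr0. Qed.

Lemma at0_const X : at0 (map_mx polyC X) = X.
Proof. by apply/rowP => i; rewrite !mxE /horner_eval hornerC. Qed.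

Lemma pev_at0 p dl : (pev dl p).[0] = p.@[at0 dl 0].
Proof. exact: pev_horner. Qed.

Lemma dirder_at0 p g h : (dirder p g h).[0] = (at0 h *m grad p (at0 g)) 0 0.
Proof.
rewrite /dirder horner_sum mxE; apply: eq_bigr => i _.
by rewrite hornerM pev_at0 !mxE.
Qed.

Lemma pev_arc1 p X dl : exists r,
  pev (arc X dl) p = (p.@[X 0])%:P + 'X * ((at0 dl *m grad p X) 0 0)%:P + 'X^2 * r.
Proof.
have [r ->] := pev_taylor p (map_mx polyC X) dl 'X.
have : 'X %| dirder p (map_mx polyC X) dl - ((at0 dl *m grad p X) 0 0)%:P.
  by rewrite dvdX_horner !hornerE dirder_at0 at0_const subrr.
move=> /dvdpP[w] /eqP; rewrite subr_eq => /eqP ->.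
by exists (w + r); rewrite pev_const; ring.
Qed.

Lemma dvdX_pev_arc p X dl : ('X %| pev (arc X dl) p) = (p.@[X 0] == 0).
Proof. by rewrite dvdX_horner pev_at0 at0_arc. Qed.

Lemma dvdX2_pev_arc p X dl : p.@[X 0] = 0 ->
  ('X^2 %| pev (arc X dl) p) = ((at0 dl *m grad p X) 0 0 == 0).
Proof.
move=> p0; have [r ->] := pev_arc1 p X dl; rewrite p0 add0r dvdp_addl; last exact: dvdp_mulr.
by rewrite expr2 dvdp_mul2l ?polyX_eq0 // dvdX_horner hornerC.
Qed.

(** The arc [(1 + t) X] stays in the cone [p = 0]. *)
Lemma euler_vanish d p X : p \is d.-homog -> p.@[X 0] = 0 -> X *m grad p X = 0.
Proof.
move=> hp p0; apply/matrixP => i j; rewrite !ord1 [RHS]mxE; apply/eqP.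
rewrite -[X in X *m _]at0_const -(dvdX2_pev_arc _ p0) /arc.
rewrite -{1}[map_mx polyC X]scale1r -scalerDl (pev_homog_scale _ _ hp) pev_const p0.
by rewrite mulr0 dvdp0.
Qed.

(** Tangent directions at a projective point do not depend on the choice of its
    coordinates. *)
Lemma grad_scale d p X c : p \is d.-homog -> c != 0 -> p.@[X 0] = 0 ->
  forall v, (v *m grad p (c *: X) == 0) = (v *m grad p X == 0).
Proof.
move=> hp c0 p0 v.
have cp0 : p.@[(c *: X) 0] = 0 by rewrite (meval_homog_scale _ _ hp) p0 mulr0.
have m0 (M : 'M[F]_1) : (M == 0) = (M 0 0 == 0).
  by apply/eqP/eqP => [->|M0]; [rewrite mxE | rewrite [M]mx11_scalar M0 raddf0].
have := dvdX2_pev_arc (map_mx polyC v) cp0.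
have := dvdX2_pev_arc (map_mx polyC (c^-1 *: v)) p0.
have -> : arc (c *: X) (map_mx polyC v) =
    c%:P *: arc X (map_mx polyC (c^-1 *: v)).
  apply/rowP => i; rewrite !mxE mulrDr mulrCA -polyCM; congr (_ + 'X * _).
  by rewrite -polyCM mulVKf.
rewrite (pev_homog_scale _ _ hp) -polyC_exp mul_polyC dvdpZr ?expf_neq0 // => ->.
rewrite !at0_const !m0 -scalemxAl mxE => <-.
by rewrite mulf_eq0 invr_eq0 (negPf c0).
Qed.

End Arcs.

(** * Points and lines of the plane *)

Section Projective.
Variable F : fieldType.

Lemma proj_eqP n (P Q : 'rV[F]_n) : P != 0 ->
  reflect (exists2 c, c != 0 & Q = c *: P) (P == Q)%MS.
Proof.
move=> P0; apply: (iffP idP) => [/andP[/sub_rVP[a Pa] /sub_rVP[c Qc]]|[c c0 ->]].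
  exists c => //; apply: contraNneq P0 => c0.
  by rewrite Pa Qc c0 scale0r scaler0.
by apply/eqmxP/eqmx_sym/eqmx_scale.
Qed.

(** The linear form on the projective line whose zero is [p]; see [det_perp]. *)
Definition perp (p : 'rV[F]_2) : 'cV[F]_2 :=
  \col_i (if i == 0 then p 0 1 else - p 0 0).

Lemma perpE (x p : 'rV[F]_2) : (x *m perp p) 0 0 = x 0 0 * p 0 1 - x 0 1 * p 0 0.
Proof. by rewrite mxE !big_ord_recl big_ord0 !mxE /= addr0 mulrN; congr (_ - x 0 _ * _); apply/val_inj. Qed.

Lemma det_perp (x p : 'rV[F]_2) : \det (col_mx x p : 'M_2) = (x *m perp p) 0 0.
Proof.
rewrite perpE (expand_det_row _ 0) !big_ord_recl big_ord0 addr0.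
have s0 : split (0 : 'I_(1 + 1)) = inl 0.
  by rewrite -[RHS](@unsplitK 1 1); congr split; apply/val_inj.
have s1 : split (lift 0 0 : 'I_(1 + 1)) = inr 0.
  by rewrite -[RHS](@unsplitK 1 1); congr split; apply/val_inj.
rewrite /cofactor !det_mx11 !mxE /= s0 s1 /= expr0 mul1r expr1 mulN1r mulrN.
by congr (x _ _ * p _ _ - x _ _ * p _ _); apply/val_inj.
Qed.

Lemma perpZ c p : perp (c *: p) = c *: perp p.
Proof. by apply/colP => i; rewrite !mxE; case: ifP; rewrite ?mulrN. Qed.

Lemma perp_eq0 p : (perp p == 0) = (p == 0).
Proof.
apply/eqP/eqP => [/colP h|->]; last by apply/colP => i; rewrite !mxE oppr0 if_same.
apply/rowP => i; have := h 0; have := h 1; rewrite !mxE /=.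
move/eqP; rewrite oppr_eq0 => /eqP h0 h1.
by case: i => [[|[|//]] lti]; [rewrite -[RHS]h0 | rewrite -[RHS]h1]; congr (p _ _); apply/val_inj.
Qed.

Lemma mul_perp_eq0 (x p : 'rV[F]_2) : x != 0 -> p != 0 -> (x *m perp p == 0) = (p == x)%MS.
Proof.
move=> x0 p0; apply/eqP/proj_eqP => // [h|[c c0 ->]].
  have : (x <= kermx (perp p))%MS by apply/sub_kermxP.
  have pk : (p <= kermx (perp p))%MS.
    by apply/sub_kermxP/matrixP => i j; rewrite !ord1 perpE mxE; ring.
  have : (kermx (perp p) <= p)%MS.
    rewrite -(geq_leqif (mxrank_leqif_sup pk)) mxrank_ker rank_rV p0.
    by rewrite -mxrank_tr rank_rV -trmx0 (inj_eq trmx_inj) perp_eq0 p0.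
  move=> kp xk; have /sub_rVP[c xc] := submx_trans xk kp; exists c => //.
  by apply: contraNneq x0 => c0; rewrite xc c0 scale0r.
by apply/matrixP => i j; rewrite !ord1 perpE !mxE; ring.
Qed.

Lemma mul_perp0 (x y : 'rV[F]_2) : x != 0 -> y *m perp x = 0 -> exists e, y = e *: x.
Proof.
move=> x0 /eqP yx; have [->|y0] := eqVneq y 0; first by exists 0; rewrite scale0r.
by move: yx; rewrite mul_perp_eq0 // => /proj_eqP-/(_ x0)[e _ ->]; exists e.
Qed.

Lemma transverse_ex (x : 'rV[F]_2) : x != 0 -> exists y : 'rV[F]_2, y *m perp x != 0.
Proof.
rewrite -perp_eq0 => x0.
have [i xi] : exists i, perp x i 0 != 0.
  apply/existsP; apply: contraNT x0 => /existsPn h; apply/eqP/colP => i.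
  by rewrite [RHS]mxE; have /negPn/eqP := h i.
exists (delta_mx 0 i); rewrite -rowE; apply: contraNneq xi => /rowP/(_ 0).
by rewrite !mxE => ->.
Qed.

End Projective.

Lemma map_hornerC (F : fieldType) m n (M : 'M[F]_(m, n)) x :
  map_mx (horner_eval x) (map_mx polyC M) = M.
Proof. by apply/matrixP => i j; rewrite !mxE /horner_eval hornerC. Qed.

Section Frames.
Variable F : fieldType.

(** Coordinates adapted to a line: [B] parametrizes the line, [a] is its linear
    form, and [Pi] projects to the line along the vector [v]. *)
Definition frame (B : 'M[F]_(2, 3)) (a : 'cV[F]_3) (v : 'rV[F]_3)
    (Pi : 'M[F]_(3, 2)) :=
  [/\ B *m a = 0, v *m a = 1%:M, B *m Pi = 1%:M & Pi *m B + a *m v = 1%:M].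

Lemma frame_ex B : \rank B = 2%N -> exists a v Pi, frame B a v Pi.
Proof.
move=> rB.
have [v vB] : exists v : 'rV[F]_3, ~~ (v <= B)%MS.
  have : ~~ ((1%:M : 'M[F]_3) <= B)%MS.
    by apply/negP => /mxrankS; rewrite rB mxrank1.
  by case/row_subPn => i h; exists (row i 1%:M).
pose M : 'M[F]_3 := col_mx B v.
have Mu : M \in unitmx.
  rewrite -row_free_unit -row_leq_rank.
  have : (B < col_mx B v)%MS.
    rewrite /ltmx -addsmxE addsmxSl /=; apply: contra vB.
    by rewrite -addsmxE; apply/submx_trans/addsmxSr.
  by rewrite ltmxErank rB => /andP[].
pose A : 'M[F]_(3, 2 + 1) := invmx M.
have AE : A = row_mx (lsubmx A) (rsubmx A) by rewrite hsubmxK.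
have e1 : row_mx (lsubmx A) (rsubmx A) *m col_mx B v = 1%:M.
  by rewrite -AE -/M mulVmx.
have : col_mx B v *m row_mx (lsubmx A) (rsubmx A) = 1%:M.
  by rewrite -AE; exact: (mulmxV Mu).
rewrite mul_row_col in e1; rewrite mul_col_row scalar_mx_block.
case/eq_block_mx => BP Ba vP va.
by exists (rsubmx A), v, (lsubmx A).
Qed.

Section Frame.
Variables (B : 'M[F]_(2, 3)) (a : 'cV[F]_3) (v : 'rV[F]_3) (Pi : 'M[F]_(3, 2)).
Hypothesis fr : frame B a v Pi.
Local Notation C := (map_mx (@polyC F)).

Lemma frame_normal_neq0 : a != 0.
Proof.
case: fr => _ va _ _; apply: contraTneq isT => a0.
by move/matrixP: va => /(_ 0 0) /eqP; rewrite a0 mulmx0 !mxE eqxx eq_sym oner_eq0.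
Qed.

Lemma on_line m (X : 'M[F]_(m, 3)) : X *m a = 0 -> X = X *m Pi *m B.
Proof.
case: fr => _ _ _ e Xa; rewrite -[LHS]mulmx1 -e mulmxDr !mulmxA Xa mul0mx.
by rewrite addr0.
Qed.

Lemma line_inj m (x y : 'M[F]_(m, 2)) : x *m B = y *m B -> x = y.
Proof.
by case: fr => _ _ BP _ e; rewrite -[x]mulmx1 -BP mulmxA e -mulmxA BP mulmx1.
Qed.

Lemma line_free : row_free B.
Proof. by case: fr => _ _ BP _; apply/row_freeP; exists Pi. Qed.

Lemma line_proj m1 m2 (p : 'M_(m1, 2)) (x : 'M_(m2, 2)) :
  (p *m B == x *m B)%MS = (p == x)%MS.
Proof. by rewrite !submxMfree ?line_free. Qed.

Lemma line_eq0 (x : 'rV_2) : (x *m B == 0) = (x == 0).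
Proof.
by apply/eqP/eqP => [e|->]; [apply: line_inj; rewrite e mul0mx | rewrite mul0mx].
Qed.

Lemma split_line (g : 'rV[{poly F}]_3) :
  g = g *m C Pi *m C B + (g *m C a) 0 0 *: C v.
Proof.
case: fr => _ _ _ e; rewrite -mul_scalar_mx -mx11_scalar -!mulmxA -mulmxDr.
by rewrite -!map_mxM -map_mxD e map_mx1 mulmx1.
Qed.

(** Taylor expansion of [p] around the line in the direction [v].  The term of
    first order is kept because [contact] needs its value at [t = 0]. *)
Lemma pev_line (g : 'rV[{poly F}]_3) p : exists r,
  pev g p = pev (g *m C Pi) (p \mPo lforms B)
    + pev g (lform a) * (dirder p (g *m C Pi *m C B) (C v)
    + pev g (lform a) * r).
Proof.
have [r e] := pev_taylor p (g *m C Pi *m C B) (C v) (pev g (lform a)).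
exists r; rewrite {1}[g]split_line -pev_lform e pev_lforms; ring.
Qed.
End Frame.
End Frames.

(** * Contact of a line with a branch of the curve *)

Section Contact.
Variables (F : closedFieldType) (f : {mpoly F[3]}) (d : nat).
Hypothesis f_homog : f \is d.-homog.

(** A branch of the curve at [X] with parameter [t], known up to [t ^ N].  The
    vector [at0 dl] is independent of [X], so that in the projective plane the
    arc has a nonzero velocity at [t = 0]. *)
Definition branch (N : nat) (X : 'rV[F]_3) dl :=
  \rank (col_mx X (at0 dl)) = 2%N /\ 'X^N %| pev (arc X dl) f.

(** A linear form that vanishes at [x] has a simple zero on every arc that
    leaves [x] transversally. *)
Lemma ord0_section (L : seq 'rV[F]_2) x mu : x != 0 -> all (fun p => p != 0) L ->
  at0 mu *m perp x != 0 ->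
  ord0 (\prod_(p <- L) pev (arc x mu) (lform (perp p)))
       (count (fun p => (p == x)%MS) L).
Proof.
move=> x0 L0 mux; elim: L L0 => [_|p L IH /= /andP[p0 /IH{}IH]].
  by rewrite big_nil; apply: ord0_unit; rewrite hornerC oner_eq0.
rewrite big_cons; apply: ord0M => //.
have xp := mul_perp_eq0 x0 p0; have [px|px] := boolP (p == x)%MS; last first.
  rewrite (negPf px) in xp *; apply: ord0_unit; rewrite pev_at0 at0_arc meval_lform.
  by apply: contraFneq xp => e; apply/eqP/matrixP => i j; rewrite !ord1 e mxE.
have [c c0 xE] : exists2 c, c != 0 & p = c *: x.
  by apply/proj_eqP => //; rewrite andbC.
rewrite px in xp *.
exists ((mu *m map_mx polyC (perp p)) 0 0).
  rewrite xE perpZ map_mxZ -scalemxAr mxE hornerM hornerC mulf_neq0 //.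
  apply: contraNneq mux => e; apply/eqP/matrixP => i j; rewrite !ord1 [RHS]mxE -e.
  by rewrite !mxE horner_sum; apply: eq_bigr => k _; rewrite !mxE hornerM hornerC.
move/eqP: xp => xp; rewrite pev_lform mulmxDl -map_mxM xp map_mx0 add0r.
by rewrite -scalemxAl mxE expr1.
Qed.

(** Intersection multiplicities may be computed on the line or on the curve.
    Let [l] be the linear form of the line on the branch, and project the branch
    to the line along [v].  By [pev_line], [f] on the projected arc is [- l]
    times a series with constant term [v *m grad f X], up to [t ^ N].  When
    [k > 1], the gradient is orthogonal to the line, and so not to [v], because
    [X] is nonsingular.  If the projected arc leaves [X] to the first order, then
    [f] has order [k] on it, the constant term is nonzero, and [l] has order [k].
    Otherwise the branch crosses the line, [l] has order one, and the gradient is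
    orthogonal to [v], whence [k = 1].  The second conclusion transfers a zero of
    [g] on the branch to an arc on the line; in the first case, [g] on the branch
    and on the projected arc differ by a multiple of [l]. *)
Lemma contact N B a v Pi L c X dl : frame B a v Pi -> c != 0 ->
  all (fun p => p != 0) L ->
  f \mPo lforms B = c *: \prod_(p <- L) lform (perp p) ->
  nonsingular_point f X -> branch N X dl -> (size L < N)%N -> (1 < N)%N ->
  let k := count (fun p => (p *m B == X)%MS) L in
  ord0 (pev (arc X dl) (lform a)) k /\
  (forall x g j, X = x *m B -> (j <= k)%N -> 'X^j %| pev (arc X dl) g ->
   exists mu, at0 mu *m perp x != 0 /\
    'X^j %| pev (arc x mu) (g \mPo lforms B)).
Proof.
move=> fr c0 L0 fB [X0 fX [i0 dfX]] [rk fN] LN N1 k.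
have f1 x mu : x != 0 -> at0 mu *m perp x != 0 ->
    ord0 (pev (arc x mu) (f \mPo lforms B)) (count (fun p => (p == x)%MS) L).
  move=> x0 mux; rewrite fB pevZ rmorph_prod -[count _ _]add0n; apply: ord0M.
    by apply: ord0_unit; rewrite hornerC.
  exact: ord0_section.
have [Xa|Xa] := eqVneq (X *m a) 0; last first.
  have Xx x : X != x *m B.
    by apply: contraNneq Xa => ->; case: fr => Ba _ _ _; rewrite -mulmxA Ba mulmx0.
  have -> : k = 0%N.
    apply/eqP; rewrite -leqn0 leqNgt -has_count; apply/hasPn => p pL.
    have pB0 : p *m B != 0 by rewrite (line_eq0 fr) (allP L0).
    by apply/negP => /proj_eqP-/(_ pB0)[e e0 XE]; case/eqP: (Xx (e *: p)); rewrite -scalemxAl.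
  split=> [|x g j XE]; last by case/eqP: (Xx x).
  apply: ord0_unit; rewrite pev_at0 at0_arc meval_lform.
  by apply: contraNneq Xa => e; apply/eqP/matrixP => i j; rewrite !ord1 e mxE.
have XE := on_line fr Xa; move: (X *m Pi) XE => x XE.
have x0 : x != 0 by rewrite -(line_eq0 fr) -XE.
have kE : k = count (fun p => (p == x)%MS) L.
  by apply: eq_count => p /=; rewrite XE (line_proj fr).
suff [H1 H2] : ord0 (pev (arc X dl) (lform a)) k /\
    (forall g j, (j <= k)%N -> 'X^j %| pev (arc X dl) g ->
    exists mu, at0 mu *m perp x != 0 /\
    'X^j %| pev (arc x mu) (g \mPo lforms B)).
  split=> // y g j; rewrite {1}XE => /(line_inj fr) <-; exact: H2.
rewrite {}kE {k}; set k := count _ L.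
have XB mu : pev (arc x mu) (f \mPo lforms B) = pev (arc X (mu *m map_mx polyC B)) f.
  by rewrite pev_lforms /arc mulmxDl -map_mxM -XE scalemxAl.
have at0B mu : at0 (mu *m map_mx polyC B) = at0 mu *m B.
  rewrite /at0 map_mxM; congr (_ *m _); exact: map_hornerC.
have k1 : (0 < k)%N.
  have [y y0] := transverse_ex x0.
  apply: (ord0_max (f1 x (map_mx polyC y) x0 _)); first by rewrite at0_const.
  by rewrite expr1 XB dvdX_pev_arc fX.
have parx y := @mul_perp0 _ x y x0.
have Xgrad := euler_vanish f_homog fX.
(* Along the line f has a multiple zero at X, so all derivatives of f in
   directions of the line vanish; a further direction makes X singular. *)
have sing : (1 < k)%N -> v *m grad f X != 0.
  move=> k2; apply/eqP => vg.
  suff : grad f X = 0.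
    by move/colP/(_ i0)/eqP; rewrite !mxE (negPf dfX).
  rewrite -[LHS]mul1mx; case: fr => _ _ _ <-.
  rewrite mulmxDl -mulmxA -[(a *m v) *m _]mulmxA vg mulmx0 addr0.
  rewrite (_ : B *m grad f X = 0) ?mulmx0 //; apply/row_matrixP => i.
  rewrite row0 row_mul; set y := row i B.
  pose z : 'rV[F]_2 := delta_mx 0 i; have -> : y = z *m B by rewrite -rowE.
  have [/parx[e ->]|zx] := eqVneq (z *m perp x) 0.
    by rewrite -scalemxAl -XE -scalemxAl Xgrad scaler0.
  have : 'X^2 %| pev (arc x (map_mx polyC z)) (f \mPo lforms B).
    apply: dvdp_trans (ord0_dvd (f1 _ _ x0 _)); last by rewrite at0_const.
    by rewrite dvdp_exp2l.
  rewrite XB dvdX2_pev_arc // at0B at0_const => /eqP h.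
  by apply/matrixP => ? ?; rewrite !ord1 h mxE.
pose mu := dl *m map_mx polyC Pi.
have uE : arc X dl *m map_mx polyC Pi = arc x mu.
  rewrite /arc mulmxDl -map_mxM XE -mulmxA scalemxAl.
  by case: fr => _ _ -> _; rewrite mulmx1.
have lE : pev (arc X dl) (lform a) = 'X * (dl *m map_mx polyC a) 0 0.
  rewrite pev_lform /arc mulmxDl -map_mxM XE -mulmxA.
  by case: fr => -> _ _ _; rewrite mulmx0 map_mx0 add0r -scalemxAl mxE.
have [r fE] := pev_line fr (arc X dl) f; rewrite uE in fE.
set l := pev _ (lform a) in lE fE *.
set D := dirder _ _ _ in fE.
have D0 : D.[0] = (v *m grad f X) 0 0.
  rewrite dirder_at0 at0_const; congr ((_ *m grad f _) _ _).
  by rewrite at0B at0_arc XE.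
have h0 : (D + l * r).[0] = (v *m grad f X) 0 0.
  by rewrite lE !hornerE D0 ?mul0r ?addr0.
have kN : (k < N)%N by apply: leq_ltn_trans LN; apply: count_size.
(* The main case is that of an arc mu that leaves x transversally. *)
have [mux|mux] := eqVneq (at0 mu *m perp x) 0; last first.
  have o1 := f1 x mu x0 mux; rewrite -/k in o1.
  have vg : (v *m grad f X) 0 0 != 0.
    apply: contraTneq k1 => vg; rewrite -leqNgt leqNgt; apply/negP => _.
    have k2 : (1 < k)%N.
      apply: (ord0_max o1).
      have -> : pev (arc x mu) (f \mPo lforms B) = pev (arc X dl) f - l * (D + l * r).
        by rewrite fE addrK.
      apply: dvdp_sub; first by apply: dvdp_trans fN; rewrite dvdp_exp2l.
      rewrite expr2 dvdp_mul // ?lE ?dvdp_mulr // -lE dvdX_horner h0 vg //.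
    by case/eqP: (sing k2); apply/matrixP => ? ?; rewrite !ord1 vg mxE.
  have ol : ord0 l k.
    apply: (@ord0_divr _ _ (D + l * r)); last by rewrite h0.
    apply: (ord0_congr (m := N) (p := - pev (arc x mu) (f \mPo lforms B))) => //.
      by case: o1 => w w0 ->; exists (- w); rewrite ?mulrN // hornerN oppr_eq0.
    by rewrite opprK addrC -fE.
  split=> // g j jk gj; exists mu; split=> //.
  have [r' gE] := pev_line fr (arc X dl) g; rewrite uE in gE.
  rewrite (_ : pev _ _ = pev (arc X dl) g - l *
    (dirder g (arc x mu *m map_mx polyC B) (map_mx polyC v) + l * r')); last first.
    by rewrite gE addrK.
  rewrite dvdp_sub // dvdp_mulr //; apply: dvdp_trans (ord0_dvd ol).
  by rewrite dvdp_exp2l.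
(* Now the projected arc stays at X to the first order. *)
have [e muE] := parx _ mux.
have la : (at0 dl *m a) 0 0 != 0.
  apply: contraTneq isT => la; move: rk.
  have -> : at0 dl = e *: X.
    rewrite (@on_line _ _ _ _ _ fr _ (at0 dl)); last first.
      by apply/matrixP => ? ?; rewrite !ord1 la mxE.
    rewrite XE scalemxAl -muE; congr (_ *m _).
    rewrite /mu /at0 map_mxM; congr (_ *m _); exact/esym/map_hornerC.
  have : (col_mx X (e *: X) <= X)%MS by rewrite col_mx_sub submx_refl scalemx_sub.
  by move/mxrankS => + r2; rewrite r2 rank_rV; case: (X != 0).
have ol : ord0 l 1.
  exists ((dl *m map_mx polyC a) 0 0); last by rewrite expr1.
  rewrite (_ : _.[0] = (at0 dl *m a) 0 0) //.
  by rewrite !mxE horner_sum; apply: eq_bigr => j _; rewrite !mxE hornerM hornerC.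
have vg : v *m grad f X = 0.
  apply/matrixP => ? ?; rewrite !ord1 [RHS]mxE -h0; apply/eqP.
  rewrite -dvdX_horner; apply: (ord0_cancel (r := 1) (m := 1) ol).
  have -> : l * (D + l * r) = pev (arc X dl) f - pev (arc x mu) (f \mPo lforms B).
    by rewrite fE addrAC subrr add0r.
  apply: dvdp_sub; first by apply: dvdp_trans fN; rewrite dvdp_exp2l.
  by rewrite XB dvdX2_pev_arc // at0B muE -scalemxAl -XE -scalemxAl Xgrad scaler0 mxE.
have kE : k = 1%N.
  apply/eqP; rewrite eqn_leq k1 andbT leqNgt; apply/negP => /sing.
  by rewrite vg eqxx.
rewrite kE; split=> // g [_ _|[_|//]].
  have [y yx] := transverse_ex x0; exists (map_mx polyC y).
  by rewrite at0_const expr0 dvd1p.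
rewrite expr1 dvdX_pev_arc => /eqP gX.
have [y yx] := transverse_ex x0; exists (map_mx polyC y).
by rewrite at0_const dvdX_pev_arc meval_lforms -XE gX.
Qed.

End Contact.

Lemma rank_pair (F : fieldType) n (X w : 'rV[F]_n) :
  X != 0 -> ~~ (w <= X)%MS -> \rank (col_mx X w) = 2%N.
Proof.
move=> X0 wX; apply/eqP; rewrite eqn_leq rank_leq_row /=.
have : (X < col_mx X w)%MS.
  rewrite /ltmx -addsmxE addsmxSl /=; apply: contra wX.
  by rewrite -addsmxE; apply/submx_trans/addsmxSr.
by rewrite ltmxErank rank_rV X0 => /andP[].
Qed.

Section Branches.
Variables (F : closedFieldType) (f : {mpoly F[3]}) (d : nat).
Hypothesis f_homog : f \is d.-homog.

(** The kernel of the gradient is a plane, while [X] spans a line. *)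
Lemma tangent_ex X : nonsingular_point f X ->
  exists2 w : 'rV[F]_3, w *m grad f X = 0 & ~~ (w <= X)%MS.
Proof.
move=> [X0 fX [i0 dfX]].
have : ~~ (kermx (grad f X) <= X)%MS.
  apply/negP => /mxrankS; rewrite mxrank_ker rank_rV X0 -mxrank_tr.
  by have := rank_leq_row (grad f X)^T; case: (\rank _) => [|[|]].
by case/row_subPn => i wX; exists (row i (kermx (grad f X))) => //; apply/sub_kermxP/row_sub.
Qed.

(** Newton iteration: a tangent vector extends to a branch of any order. *)
Lemma branch_ex N X : nonsingular_point f X -> exists dl, branch f N X dl.
Proof.
move=> nsX; have [w wG wX] := tangent_ex nsX.
move: nsX => [X0 fX [i0 dfX]].
pose v : 'rV[F]_3 := delta_mx 0 i0.
have vG : (v *m grad f X) 0 0 != 0 by rewrite -rowE !mxE.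
suff [dl dl0 h] : exists2 dl, at0 dl = w & 'X^(N.+2) %| pev (arc X dl) f.
  exists dl; split; first by rewrite dl0; apply: rank_pair.
  by apply: dvdp_trans h; rewrite dvdp_exp2l // ltnW.
elim: N => [|N [dl dl0 /dvdpP[q fE]]].
  exists (map_mx polyC w); first exact: at0_const.
  by rewrite dvdX2_pev_arc // at0_const wG mxE.
(* A correction in the direction v, in which f has a nonzero derivative,
   removes the coefficient of t ^ (N + 2). *)
pose c := - q.[0] / (v *m grad f X) 0 0.
pose s : {poly F} := 'X^(N.+2).
exists (dl + ('X^(N.+1) * c%:P) *: map_mx polyC v).
  rewrite -dl0; apply/rowP => i; rewrite !mxE /horner_eval !hornerE expr0n /=.
  by rewrite ?mul0r ?addr0.
have -> : arc X (dl + ('X^(N.+1) * c%:P) *: map_mx polyC v) =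
    arc X dl + s *: (map_mx polyC (c *: v)).
  rewrite /arc scalerDr addrA scalerA map_mxZ scalerA; congr (_ + _ *: _).
  by rewrite /s [in RHS]exprS mulrA.
have [r ->] := pev_taylor f (arc X dl) (map_mx polyC (c *: v)) s.
rewrite fE (_ : _ + _ = s * (q + dirder f (arc X dl) (map_mx polyC (c *: v)) + s * r)).
  rewrite exprSr dvdp_mul2l ?expf_neq0 ?polyX_eq0 // dvdX_horner !hornerE.
  rewrite dirder_at0 at0_const at0_arc -scalemxAl mxE /c divfK // subrr.
  by rewrite expr0n mul0r addr0.
by rewrite /s; ring.
Qed.
End Branches.

(** * Max Noether's theorem for a line *)

Section BinaryForms.
Variable F : closedFieldType.

(** The linear factors are split off one at a time; each of them accounts for
    one order of vanishing on an arc that leaves its zero transversally. *)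
Lemma bin_div (b : {mpoly F[2]}) (L : seq 'rV[F]_2) : all (fun p => p != 0) L ->
  (forall x, x != 0 -> exists mu, at0 mu *m perp x != 0 /\
     'X^(count (fun p => (p == x)%MS) L) %| pev (arc x mu) b) ->
  exists h, b = \prod_(p <- L) lform (perp p) * h.
Proof.
elim: L b => [|p L IH] b; first by move=> _ _; exists b; rewrite big_nil mul1r.
move=> /= /andP[p0 L0] bL.
have bp e : e != 0 -> b.@[(e *: p) 0] = 0.
  move=> e0; have [|mu [_]] := bL (e *: p); first by rewrite scaler_eq0 negb_or e0.
  have -> : (p == e *: p)%MS by apply/proj_eqP => //; exists e.
  rewrite add1n exprS => /(dvdp_trans (dvdp_mulr _ (dvdpp _))).
  by rewrite dvdX_pev_arc => /eqP.
have [|v vp|b' bE] := @lform_dvd _ _ (perp p) b; first by rewrite perp_eq0.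
  (* b need not be homogeneous; it vanishes on the line through p minus the
     origin, hence on the whole line. *)
  have [e ->] := mul_perp0 p0 vp.
  have : pev ('X *: map_mx polyC p) b = 0.
    apply: poly_eq0_eval => x /bp <-; rewrite pev_horner; apply: meval_eq => i.
    by rewrite !mxE /horner_eval !hornerE.
  move/(congr1 (horner^~ e)); rewrite horner0 pev_horner => <-; apply: meval_eq => i.
  by rewrite !mxE /horner_eval !hornerE.
have [x x0|h b'E] := IH b' L0; last by exists h; rewrite big_cons -mulrA -b'E.
have [mu [mux b0]] := bL x x0; exists mu; split=> //.
have p0' : all (fun q : 'rV_2 => q != 0) [:: p] by rewrite /= p0.
have := ord0_section x0 p0' mux; rewrite big_seq1 /= addn0 => op.
by move: b0; rewrite bE rmorphM; apply: ord0_cancel.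
Qed.
End BinaryForms.

Section Cubic.
Variables (F : closedFieldType) (f : {mpoly F[3]}).

Definition multiple (g : {mpoly F[3]}) := exists h, g = f * h.

Lemma nonsingularP X :
  nonsingular_point f X <-> [/\ X != 0, f.@[X 0] = 0 & grad f X != 0].
Proof.
split=> -[X0 fX h]; split=> //.
  by case: h => i di; apply: contraNneq di => /colP/(_ i); rewrite !mxE => ->.
apply/existsP; apply: contraNT h => /existsPn h; apply/eqP/colP => i.
by rewrite !mxE; have /negPn/eqP := h i.
Qed.

Definition mult (X : 'rV[F]_3) (D : seq 'rV[F]_3) := count (fun Y => (Y == X)%MS) D.

Hypothesis f_homog : f \is 3.-homog.

Lemma nonsingular_proj X Y : nonsingular_point f X -> (X == Y)%MS ->
  nonsingular_point f Y.
Proof.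
move=> /nonsingularP[X0 fX gX] /proj_eqP-/(_ X0)[c c0 ->].
apply/nonsingularP; split; first by rewrite scaler_eq0 negb_or c0.
  by rewrite (meval_homog_scale _ _ f_homog) fX mulr0.
apply: contraNneq gX => g0; apply/eqP/row_matrixP => i; rewrite row0 rowE; apply/eqP.
by rewrite -(grad_scale f_homog c0 fX) g0 mulmx0.
Qed.

(** [D] is the divisor that the line with linear form [a] cuts on the curve. *)
Definition linear_section (a : 'cV[F]_3) (D : seq 'rV[F]_3) :=
  exists B v Pi L c, [/\ frame B a v Pi, c != 0, all (fun p => p != 0) L,
    f \mPo lforms B = c *: \prod_(p <- L) lform (perp p) &
    D = [seq p *m B | p <- L]].

Lemma contact_form N a D X dl : linear_section a D ->
  nonsingular_point f X -> branch f N X dl -> (size D < N)%N -> (1 < N)%N ->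
  ord0 (pev (arc X dl) (lform a)) (mult X D).
Proof.
move=> [B [v [Pi [L [c [fr c0 L0 fB ->]]]]]] nsX br; rewrite size_map => DN N1.
by rewrite /mult count_map; have [] := contact f_homog fr c0 L0 fB nsX br DN N1.
Qed.

(** [f] is nonzero on the line, and polynomials on the line form a domain. *)
Lemma line_prime B a v Pi h q : frame B a v Pi -> f \mPo lforms B != 0 ->
  f * h = lform a * q -> exists h', h = lform a * h'.
Proof.
move=> fr fB e; apply: lform_dvd; first exact: frame_normal_neq0 fr.
move=> w wa; rewrite (on_line fr wa) -meval_lforms.
suff -> : h \mPo lforms B = 0 by rewrite meval0.
apply: (mulfI fB); rewrite mulr0 -rmorphM /= e rmorphM /=.
suff -> : lform a \mPo lforms B = 0 by rewrite mul0r.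
apply: mpoly_eq_eval => x; rewrite meval_lforms meval_lform meval0.
by case: fr => Ba _ _ _; rewrite -mulmxA Ba mulmx0 mxE.
Qed.

Lemma lform_neq0 n (a : 'cV[F]_n) : a != 0 -> lform a != 0.
Proof.
move=> a0; apply: contraNneq a0 => la; apply/eqP/row_matrixP => i.
rewrite row0 rowE; apply/matrixP => j k; rewrite !ord1.
by rewrite -meval_lform la meval0 mxE.
Qed.

Lemma section_neq0 (L : seq 'rV[F]_2) c : c != 0 -> all (fun p => p != 0) L ->
  c *: \prod_(p <- L) lform (perp p) != 0.
Proof.
move=> c0 /allP L0; rewrite -mul_mpolyC mulf_neq0 ?mpolyC_eq0 //.
rewrite prodf_seq_neq0; apply/allP => p /L0 p0 /=.
by rewrite lform_neq0 // perp_eq0.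
Qed.

Lemma multiple_lform_mul a D g : linear_section a D ->
  multiple (lform a * g) -> multiple g.
Proof.
move=> [B [v [Pi [L [c [fr c0 L0 fB _]]]]]] [h e].
have fB0 : f \mPo lforms B != 0 by rewrite fB section_neq0.
have [h' hE] := line_prime fr fB0 (esym e); exists h'.
have a0 := lform_neq0 (frame_normal_neq0 fr).
by apply: (mulfI a0); rewrite e hE; ring.
Qed.

(** The quotient [h0] on the line extends to the plane by means of the projection
    [Pi]; the difference [g - f * h] then vanishes on the line. *)
Lemma noether_mod e B a v Pi g h0 : frame B a v Pi -> g \is e.+1.-homog ->
  g \mPo lforms B = (f \mPo lforms B) * h0 ->
  exists h g', [/\ h \is (e.+1 - 3).-homog, g' \is e.-homog &
    g = f * h + lform a * g'].
Proof.
move=> fr hg gB; pose h := h0 \mPo lforms Pi.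
have [w wa|g' gE] := @lform_dvd F _ a (g - f * h) (frame_normal_neq0 fr).
  rewrite mevalB mevalM [in X in _ - _ * X]meval_lforms.
  rewrite [in g.@[_]](on_line fr wa) [in f.@[_]](on_line fr wa) -!meval_lforms.
  by rewrite gB rmorphM /= mevalM subrr.
have {}gE : g = f * h + lform a * g' by rewrite -gE addrC subrK.
(* For e < 2 the degree e + 1 - 3 is truncated to 0, whereas multiples of f
   have no component of degree e + 1. *)
exists (if (e < 2)%N then 0 else pihomog mdeg (e.+1 - 3) h).
exists (pihomog mdeg e g'); split; first by case: ifP; rewrite ?pihomogP ?dhomog0.
  exact: pihomogP.
rewrite -(pihomog_dE hg) gE raddfD /=; congr (_ + _).
  case: ltnP => e2; first by rewrite (pihomogM_small _ f_homog) ?mulr0.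
  by rewrite (pihomogM _ f_homog).
by rewrite (pihomogM _ (dhomog_lform a)) // subn1.
Qed.

(** By [contact], the orders of [g] on the branches become orders of its
    restriction to the line, which is therefore divisible by the restriction of
    [f] by [bin_div]. *)
Lemma noether e a D g : linear_section a D -> g \is e.+1.-homog ->
  (forall X, X \in D -> nonsingular_point f X) ->
  (forall X, nonsingular_point f X -> exists N dl,
     [/\ branch f N X dl, (size D < N)%N, (1 < N)%N &
      'X^(mult X D) %| pev (arc X dl) g]) ->
  exists h g', [/\ h \is (e.+1 - 3).-homog, g' \is e.-homog &
    g = f * h + lform a * g'].
Proof.
move=> [B [v [Pi [L [c [fr c0 L0 fB ->]]]]]] hg nsD gD.
have [x x0|h0 gB] := @bin_div F (g \mPo lforms B) L L0.
  have [cnt0|] := posnP (count (fun p => (p == x)%MS) L).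
    have [y yx] := transverse_ex x0; exists (map_mx polyC y).
    by rewrite at0_const cnt0 expr0 dvd1p.
  rewrite -has_count => /hasP[p pL px].
  have nsX : nonsingular_point f (x *m B).
    apply: (@nonsingular_proj (p *m B)); first by apply/nsD/map_f.
    by rewrite (line_proj fr).
  have [N [dl [br DN N1]]] := gD _ nsX; rewrite size_map in DN.
  have [_ /(_ x g _ erefl (leqnn _))] := contact f_homog fr c0 L0 fB nsX br DN N1.
  rewrite /mult count_map => h /h[mu [mux gmu]]; exists mu; split=> //.
  by rewrite (eq_count (a2 := fun p => (p *m B == x *m B)%MS)) // => q /=;
     rewrite (line_proj fr).
apply: (noether_mod fr hg (h0 := c^-1 *: h0)).
by rewrite gB fB -scalerAr -scalerAl scalerA mulVf // scale1r.
Qed.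
End Cubic.

Lemma homog1_lform (F : fieldType) n (h : {mpoly F[n]}) : h \is 1.-homog ->
  h = lform (\col_i h@_U_(i)).
Proof.
move=> hh; apply/mpolyP => m; rewrite /lform tnth_mktuple raddf_sum /=.
have [/mdeg1P[i /eqP ->]|m1] := boolP (mdeg m == 1%N).
  rewrite (bigD1 i) //= big1 => [|j ji]; rewrite mcoeffZ mcoeffXU !mxE.
    by rewrite eqxx mulr1 addr0.
  by rewrite (negPf ji) mulr0.
rewrite (dhomog_nemf_coeff hh) // big1 // => i _.
rewrite mcoeffZ mcoeffX; case: eqP => [e|]; last by rewrite mulr0.
by rewrite -e mdeg1 in m1.
Qed.

(** * Chords and tangents of the cubic *)

Section Chords.
Variables (F : closedFieldType) (f : {mpoly F[3]}).
Hypothesis f_homog : f \is 3.-homog.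
Hypothesis no_line : forall B : 'M[F]_(2, 3), \rank B = 2%N -> f \mPo lforms B != 0.

Lemma line_section_linear P Q S : line_section f P Q S ->
  P != 0 -> Q != 0 -> S != 0 -> exists a, linear_section f a [:: P; Q; S].
Proof.
move=> [B [p [q [s [c [rB [<- <- <-] c0 fB]]]]]] P0 Q0 S0.
have [a [v [Pi fr]]] := frame_ex rB.
exists a, B, v, Pi, [:: p; q; s], c; split=> //.
  by rewrite /= -!(line_eq0 fr) P0 Q0 S0.
apply: mpoly_eq_eval => x; rewrite meval_lforms fB !big_cons big_nil mulr1.
by rewrite !det_perp mevalZ !mevalM !meval_lform mulrA.
Qed.

(** Two zeros of [f] on the chord, or on the tangent if they coincide, are
    known, and the remaining linear factor gives the third.  If it differs from
    [P] and [Q] it is a simple zero, so that the curve is nonsingular there. *)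
Lemma third_ex P Q : nonsingular_point f P -> nonsingular_point f Q ->
  exists S, nonsingular_point f S /\ line_section f P Q S.
Proof.
move=> nP nQ; have [P0 fP _] := nP; have [Q0 fQ _] := nQ.
pose p : 'rV[F]_(1 + 1) := row_mx 1%:M 0; pose y : 'rV[F]_(1 + 1) := row_mx 0 1%:M.
have p0 : p != 0.
  by apply: contraTneq isT => /(congr1 lsubmx)/matrixP/(_ 0 0)/eqP; rewrite row_mxKl !mxE oner_eq0.
have pB (w : 'rV_3) : p *m col_mx P w = P.
  by rewrite mul_row_col mul1mx mul0mx addr0.
have yB (w : 'rV_3) : y *m col_mx P w = w.
  by rewrite mul_row_col mul1mx mul0mx add0r.
have [w [q [rB qB tang]]] : exists w (q : 'rV[F]_2), [/\ \rank (col_mx P w) = 2%N,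
    q *m col_mx P w = Q & (P == Q)%MS -> w *m grad f P = 0].
  have [PQ|PQ] := boolP (P == Q)%MS.
    have [w wG wP] := tangent_ex nP.
    have /proj_eqP-/(_ P0)[c c0 ->] := PQ.
    exists w, (c *: p); split=> //; first exact: rank_pair.
    by rewrite -scalemxAl; congr (_ *: _); exact: pB.
  exists Q, y; split=> //.
  apply: rank_pair => //; apply: contra PQ => /sub_rVP[c QE].
  by apply/proj_eqP => //; exists c => //; apply: contraNneq Q0 => c0; rewrite QE c0 scale0r.
have {}pB : p *m col_mx P w = P by exact: pB.
have {}yB : y *m col_mx P w = w by exact: yB.
move: (col_mx P w : 'M_(2, 3)) rB qB pB yB => B rB qB pB yB.
have [a [v [Pi fr]]] := frame_ex rB.
have q0 : q != 0 by rewrite -(line_eq0 fr) qB.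
have yp : y *m perp p != 0.
  apply: contraTneq isT => /(mul_perp0 p0)[e] /(congr1 (fun z => rsubmx (z : 'rV_(1 + 1)))).
  rewrite [rsubmx (e *: _)]linearZ /= /y /p !row_mxKr scaler0 => /matrixP/(_ 0 0)/eqP.
  by rewrite !mxE oner_eq0.
have fB (x : 'rV[F]_2) : f.@[(x *m B) 0] = (f \mPo lforms B).@[x 0] by rewrite meval_lforms.
have pq0 : all (fun r => r != 0) [:: p : 'rV_2; q] by rewrite /= p0 q0.
have on_curve (x : 'rV[F]_2) : x != 0 -> has (fun r => (r == x)%MS) [:: p : 'rV_2; q] ->
    f.@[(x *m B) 0] = 0.
  move=> x0 /hasP[r]; rewrite !inE => rpq.
  have r0 : r != 0 by case/orP: rpq => /eqP ->.
  move=> /proj_eqP-/(_ r0)[c c0 ->]; rewrite -scalemxAl (meval_homog_scale _ _ f_homog).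
  by case/orP: rpq => /eqP ->; rewrite ?pB ?qB ?fP ?fQ mulr0.
have [x x0|h fBE] := @bin_div F (f \mPo lforms B) [:: p : 'rV_2; q] pq0.
  have [z zx] := transverse_ex x0.
  have [/andP[px qx]|] := boolP ((p == x)%MS && (q == x)%MS).
    have /proj_eqP-/(_ p0)[c c0 xE] := px.
    exists (map_mx polyC (y : 'rV_2)); rewrite at0_const.
    split; first by rewrite xE perpZ -scalemxAr scaler_eq0 negb_or c0.
    rewrite /= px qx pev_lforms /arc mulmxDl -map_mxM -scalemxAl -map_mxM yB.
    rewrite -/(arc _ _) dvdX2_pev_arc; last by rewrite on_curve //= px.
    rewrite at0_const xE -scalemxAl pB.
    have /eqP : w *m grad f P = 0.
      apply: tang; rewrite -pB -qB (line_proj fr); apply/eqmxP.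
      exact: eqmx_trans (eqmxP px) (eqmx_sym (eqmxP qx)).
    rewrite -(grad_scale f_homog c0 fP) => /eqP ->; by rewrite mxE.
  rewrite negb_and => pqx; exists (map_mx polyC z); rewrite at0_const; split=> //.
  have : (count (fun r => (r == x)%MS) [:: p : 'rV_2; q] <= 1)%N.
    by case/orP: pqx => /negPf /= ->; case: (_ == x)%MS.
  rewrite leq_eqVlt ltnS leqn0 => /orP[/eqP cnt|/eqP ->]; last by rewrite expr0 dvd1p.
  rewrite cnt expr1 dvdX_pev_arc -fB on_curve //.
  by rewrite has_count cnt.
have hE : f \mPo lforms B = \prod_(r <- [:: p : 'rV_2; q]) lform (perp r) * pihomog mdeg 1 h.
  have hom2 : \prod_(r <- [:: p : 'rV_2; q]) lform (perp r) \is 2.-homog.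
    by rewrite !big_cons big_nil mulr1; exact: (dhomogM (dhomog_lform _) (dhomog_lform _)).
  rewrite -(pihomog_dE (dhomog_lforms B f_homog)) fBE.
  by rewrite (pihomogM (k := 3) _ hom2).
have [a1 h1E] : exists a1, pihomog mdeg 1 h = lform (perp a1).
  exists (\row_i if i == 0 then - (pihomog mdeg 1 h)@_U_(1) else (pihomog mdeg 1 h)@_U_(0)).
  rewrite [LHS](homog1_lform (pihomogP _ _ _)); congr lform; apply/colP => i.
  rewrite !mxE /= opprK; case: i => [[|[|//]] lti] /=; congr (_@_U_(_)); exact/val_inj.
rewrite h1E in hE.
have s0 : a1 != 0.
  apply: contraNneq (no_line rB) => a10; rewrite hE a10.
  have -> : perp (0 : 'rV[F]_2) = 0 by apply/eqP; rewrite perp_eq0.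
  suff -> : lform (0 : 'cV[F]_2) = 0 by rewrite mulr0.
  by rewrite /lform tnth_mktuple big1 // => i _; rewrite mxE scale0r.
have fBs : f \mPo lforms B = \prod_(r <- [:: p : 'rV_2; q; a1]) lform (perp r).
  by rewrite hE !big_cons big_nil !mulr1 mulrA.
exists (a1 *m B); split; last first.
  exists B, p, q, a1, 1; split=> //; first exact: oner_neq0.
  move=> x; rewrite fB fBs !big_cons big_nil !mevalM meval1 mulr1 !meval_lform.
  by rewrite !det_perp mul1r mulrA.
have [/= /orP[pa|/orP[qa|//]]|nopq] := boolP (has (fun r => (r == a1)%MS) [:: p : 'rV_2; q]).
- by apply: (nonsingular_proj f_homog nP); rewrite -pB (line_proj fr).
- by apply: (nonsingular_proj f_homog nQ); rewrite -qB (line_proj fr).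
have [z zs] := transverse_ex s0.
have fs : f.@[(a1 *m B) 0] = 0.
  by rewrite fB hE mevalM meval_lform; have /eqP -> : a1 *m perp a1 == 0;
    rewrite ?mul_perp_eq0 ?submx_refl // mxE mulr0.
apply/nonsingularP; split=> //; first by rewrite (line_eq0 fr).
apply/eqP => gs.
have al0 : all (fun r => r != 0) [:: p : 'rV_2; q; a1] by rewrite /= p0 q0 s0.
have X2 : 'X^2 %| pev (arc a1 (map_mx polyC z)) (f \mPo lforms B).
  rewrite pev_lforms /arc mulmxDl -map_mxM -scalemxAl -map_mxM -/(arc _ _).
  by rewrite dvdX2_pev_arc // gs mulmx0 mxE.
have := ord0_section (mu := map_mx polyC z) s0 al0; rewrite at0_const => /(_ zs).
rewrite -rmorph_prod /= -fBs.
have -> : ((p == a1)%MS + ((q == a1)%MS + ((a1 == a1)%MS + 0)))%N = 1%N.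
  move: nopq; rewrite /= orbF negb_or => /andP[/negPf -> /negPf ->].
  by rewrite submx_refl.
by move=> /ord0_max/(_ X2).
Qed.

End Chords.

(** * The group law and Abel's theorem *)

Lemma homog0_const (F : fieldType) n (h : {mpoly F[n]}) :
  h \is 0.-homog -> h = (h@_0%MM)%:MP.
Proof.
move=> hh; apply/mpolyP => m; rewrite mcoeffC.
have [->|m0] := eqVneq m 0%MM; first by rewrite mulr1.
by rewrite mulr0 (dhomog_nemf_coeff hh) // mdeg_eq0.
Qed.

Section GroupLaw.
Variables (F : closedFieldType) (f : {mpoly F[3]}) (O : 'rV[F]_3).
Hypothesis f_homog : f \is 3.-homog.
Hypothesis no_line : forall B : 'M[F]_(2, 3), \rank B = 2%N -> f \mPo lforms B != 0.
Hypothesis O_infl : inflection_point f O.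

Let nsO : nonsingular_point f O. Proof. by case: O_infl. Qed.

Lemma third_pointP P Q : nonsingular_point f P -> nonsingular_point f Q ->
  nonsingular_point f (third_point f P Q) /\
  exists a, linear_section f a [:: P; Q; third_point f P Q].
Proof.
move=> nP nQ; have [nS lS] : nonsingular_point f (third_point f P Q) /\
    line_section f P Q (third_point f P Q).
  apply: (xgetPex 0 (P := fun S => nonsingular_point f S /\ line_section f P Q S)).
  exact: third_ex.
split=> //; apply: line_section_linear lS _ _ _ => //.
- by case: nP.
- by case: nQ.
- by case: nS.
Qed.

Lemma nonsingular_add P Q : nonsingular_point f P -> nonsingular_point f Q ->
  nonsingular_point f (cubic_add f O P Q).
Proof. by move=> nP nQ; apply: (third_pointP _ _).1 => //; apply: (third_pointP _ _).1. Qed.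

Definition hits (X P : 'rV[F]_3) : nat := (P == X)%MS.

Lemma mult_nil (X : 'rV[F]_3) : mult X [::] = 0%N. Proof. by []. Qed.

Lemma mult_cons X P D : mult X (P :: D) = (hits X P + mult X D)%N.
Proof. by []. Qed.

Lemma mult_cat X (D D' : seq 'rV[F]_3) : mult X (D ++ D') = (mult X D + mult X D')%N.
Proof. exact: count_cat. Qed.

Lemma mult_nseq X k P : mult X (nseq k P) = (hits X P * k)%N.
Proof. exact: count_nseq. Qed.

Definition multE := (mult_nil, mult_cons, mult_cat, mult_nseq).

(** [g] meets the curve at least in the divisor [D]; orders are measured on
    branches that are known up to order [N]. *)
Definition cut N (D : seq 'rV[F]_3) g := forall X dl,
  nonsingular_point f X -> branch f N X dl -> 'X^(mult X D) %| pev (arc X dl) g.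

(** When [D] has [3 d] points, it is then the full divisor of a form of degree
    [d]: such lists are linearly equivalent to [d] line sections. *)
Definition realized N d D := exists g,
  [/\ g \is d.-homog, ~ multiple f g & cut N D g].

Lemma eq_realized N d D D' : (forall X, mult X D = mult X D') ->
  realized N d D -> realized N d D'.
Proof.
by move=> e [g [hg mg cg]]; exists g; split=> // X dl nX br; rewrite -e; apply: cg.
Qed.

(** On a branch [f] is negligible, so the orders of [lform a] and of [g'] add up
    to the order of [g]. *)
Lemma dvd_pev_section N m g h a g' dl X r :
  pev (arc X dl) (f * h + lform a * g') = pev (arc X dl) g ->
  branch f N X dl -> ord0 (pev (arc X dl) (lform a)) r ->
  (r + m <= N)%N -> 'X^(r + m) %| pev (arc X dl) g -> 'X^m %| pev (arc X dl) g'.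
Proof.
move=> gE [_ fN] la rm gm; apply: (ord0_cancel la).
have -> : pev (arc X dl) (lform a) * pev (arc X dl) g' =
    pev (arc X dl) g - pev (arc X dl) f * pev (arc X dl) h.
  by rewrite -gE rmorphD !rmorphM /=; ring.
rewrite dvdp_sub // dvdp_mulr //; apply: dvdp_trans fN; by rewrite dvdp_exp2l.
Qed.

(** Let [R] be the third point of the line through [P] and [Q].  Multiplying the
    form by the line through [O], [R] and [P + Q] makes its divisor contain
    [P], [Q] and [R], and Noether's theorem divides by the line through these. *)
Lemma realized_add N d P Q D : nonsingular_point f P -> nonsingular_point f Q ->
  (size D + 8 <= N)%N -> realized N d (P :: Q :: D) ->
  realized N d (O :: cubic_add f O P Q :: D).
Proof.
move=> nP nQ DN [g [hg mg cg]].
have [nR [a1 sec1]] := third_pointP nP nQ.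
have [nR' [a2 sec2]] := third_pointP nsO nR.
rewrite -/(cubic_add f O P Q) in nR' sec2.
set R := third_point f P Q in nR sec1 sec2; set R' := cubic_add _ _ _ _ in nR' sec2 *.
have hlg : lform a2 * g \is d.+1.-homog by apply: (dhomogM (dhomog_lform a2) hg).
have N3 : (3 < N)%N by lia.
have N1 : (1 < N)%N by lia.
have lgm X dl : nonsingular_point f X -> branch f N X dl ->
    'X^(mult X [:: P; Q; R] + mult X (O :: R' :: D)) %| pev (arc X dl) (lform a2 * g).
  move=> nX br; rewrite rmorphM /=.
  have -> : (mult X [:: P; Q; R] + mult X (O :: R' :: D) =
      mult X [:: O; R; R'] + mult X (P :: Q :: D))%N by rewrite !multE; lia.
  rewrite exprD dvdp_mul //; first exact/ord0_dvd/(contact_form f_homog sec2 nX br).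
  exact: cg.
have [X|X nX|h [g' [hh hg' gE]]] := noether f_homog sec1 hlg.
- by rewrite !inE => /or3P[] /eqP ->.
- have [dl br] := branch_ex N nX; exists N, dl; split=> //.
  by apply: dvdp_trans (lgm _ _ nX br); rewrite dvdp_exp2l // leq_addr.
exists g'; split=> //.
  move=> [q qE]; apply: mg; apply: (multiple_lform_mul sec2).
  by exists (h + lform a1 * q); rewrite gE qE; ring.
move=> X dl nX br.
apply: (dvd_pev_section (congr1 (pev _) (esym gE)) br (contact_form f_homog sec1 nX br _ _)) => //.
  have : (mult X [:: P; Q; R] <= 3)%N by apply: count_size.
  have : (mult X (O :: R' :: D) <= (size D).+2)%N by apply: count_size.
  by lia.
exact: lgm.
Qed.

Lemma nonsingular_foldr s : (forall P, P \in s -> nonsingular_point f P) ->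
  nonsingular_point f (foldr (cubic_add f O) O s).
Proof.
elim: s => //= P s IH h; apply: nonsingular_add.
  by apply: h; rewrite mem_head.
by apply: IH => Q Qs; apply: h; rewrite inE Qs orbT.
Qed.

(** The points of [s] are added to [O] one after the other; each addition leaves
    a further [O] behind. *)
Lemma realized_foldr N d s D : (forall P, P \in s -> nonsingular_point f P) ->
  (size s + size D + 8 <= N)%N -> realized N d (O :: s ++ D) ->
  realized N d (foldr (cubic_add f O) O s :: nseq (size s) O ++ D).
Proof.
elim: s D => //= P s IH D h DN rD.
have hs Q : Q \in s -> nonsingular_point f Q.
  by move=> Qs; apply: h; rewrite inE Qs orbT.
have {IH}H : realized N d (foldr (cubic_add f O) O s :: nseq (size s) O ++ P :: D).
  apply: IH => //=; first lia.
  by apply: eq_realized rD => X; rewrite !multE; lia.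
have {}H : realized N d (P :: foldr (cubic_add f O) O s :: nseq (size s) O ++ D).
  by apply: eq_realized H => X; rewrite !multE; lia.
apply: (@eq_realized N d (O :: cubic_add f O P (foldr (cubic_add f O) O s) :: nseq (size s) O ++ D)).
  by move=> X; rewrite !multE; lia.
apply: realized_add H; first by apply: h; rewrite mem_head.
  exact: nonsingular_foldr.
by rewrite size_cat size_nseq; lia.
Qed.

Lemma realized_mul N d s k D : (0 < size s)%N ->
  (forall P, P \in s -> nonsingular_point f P) ->
  (size s * k + size D + 9 <= N)%N ->
  let S := foldr (cubic_add f O) O s in
  realized N d (O :: flatten (nseq k s) ++ D) ->
  realized N d (O :: nseq k S ++ nseq (k * (size s).-1) O ++ D).
Proof.
move=> s0 hs DN S; elim: k D DN => [|k IH] D DN //= rD.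
have szk : size (flatten (nseq k s)) = (size s * k)%N.
  by rewrite size_flatten /shape map_nseq sumn_nseq.
rewrite mulnS in DN.
have rS : realized N d (S :: nseq (size s) O ++ flatten (nseq k s) ++ D).
  apply: realized_foldr => //; first by rewrite size_cat szk; lia.
  by rewrite catA.
have := IH (S :: nseq (size s).-1 O ++ D).
rewrite /= size_cat size_nseq => /(_ _ _)-H.
apply: (eq_realized _ (H _ _)) => [X||].
- by rewrite !multE ?mulnS ?mulSn !mulnDr; lia.
- by move: DN s0; move: (size s) (size D) => y z; lia.
apply: eq_realized rS => X.
rewrite !multE -{1}(prednK s0) mulnS.
by move: (hits X S) (hits X O) (mult X D) (mult X (flatten _)) (size s).-1 => *; lia.
Qed.

(** The inflectional tangent at [O] cuts out three times [O]; dividing by it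
    lowers [d].  A line that contains [T] and meets the curve twice in [O] is
    this tangent, whose only point on the curve is [O]. *)
Lemma realized_inflection N d T : nonsingular_point f T -> (3 * d + 9 <= N)%N ->
  realized N d.+1 (T :: nseq (3 * d + 2) O) -> (T == O)%MS.
Proof.
move=> nT; have [_ lO] := O_infl; have [O0 fO _] := nsO.
have [a secO] := line_section_linear lO O0 O0 O0.
elim: d => [|d IH] DN [g [hg mg cg]].
  have N1 : (1 < N)%N by lia.
  have N3 : (3 < N)%N by lia.
  have [B [v [Pi [L [c [fr c0 L0 fB LE]]]]]] := secO.
  have [o LoE oB] : exists2 o, L = [:: o; o; o] & o *m B = O.
    case: L LE {L0 fB} => [//|o1 [//|o2 [//|o3 [|//]]]] [e1 e2 e3]; exists o1 => //.
    by congr [:: _; _; _]; apply: (line_inj fr); rewrite -?e1 -?e2 -?e3.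
  have o0 : o != 0 by rewrite -(line_eq0 fr) oB.
  have oo : all (fun p => p != 0) [:: o; o] by rewrite /= o0.
  have [x x0|h gB] := @bin_div F (g \mPo lforms B) [:: o; o] oo.
    have [ox|ox] := boolP (o == x)%MS; last first.
      have [y yx] := transverse_ex x0; exists (map_mx polyC y).
      by rewrite at0_const /= (negPf ox) expr0 dvd1p.
    have Ox : (O == x *m B)%MS by rewrite -oB (line_proj fr).
    have nX := nonsingular_proj f_homog nsO Ox.
    have [dl br] := branch_ex N nX.
    have szL : (size L < N)%N by rewrite LoE.
    have [_ H] := contact f_homog fr c0 L0 fB nX br szL N1.
    rewrite (_ : count _ _ = 2%N) /= ?ox //; apply: (H x g 2%N erefl).
      by rewrite LoE /= !(line_proj fr) ox.
    apply: dvdp_trans (cg _ _ nX br).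
    by rewrite dvdp_exp2l // /mult /= Ox !addn0 leq_addl.
  have gB0 : g \mPo lforms B = 0.
    rewrite -(pihomog_dE (dhomog_lforms B hg)) gB.
    apply: (pihomogM_small (e := 2)) => //; rewrite !big_cons big_nil mulr1.
    exact: (dhomogM (dhomog_lform _) (dhomog_lform _)).
  have [w wa|q qE] := @lform_dvd F _ a g (frame_normal_neq0 fr).
    by rewrite (on_line fr wa) -meval_lforms gB0 meval0.
  have [k gE] : exists k, g = lform a * k%:MP.
    exists (pihomog mdeg 0 q)@_0%MM; rewrite -(homog0_const (pihomogP _ _ _)).
    by rewrite -[LHS](pihomog_dE hg) qE (pihomogM _ (dhomog_lform a)).
  have gT : g.@[T 0] = 0.
    have [dl br] := branch_ex N nT; apply/eqP; rewrite -(dvdX_pev_arc g T dl).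
    apply: dvdp_trans (cg _ _ nT br).
    by rewrite /mult /= submx_refl exprS dvdp_mulr.
  have k0 : k != 0.
    apply: contra_notN mg => /eqP k0; exists 0.
    by rewrite gE k0 mpolyC0 !mulr0.
  have Ta : T *m a = 0.
    move/eqP: gT; rewrite gE mevalM mevalC mulf_eq0 (negPf k0) orbF meval_lform.
    by move=> /eqP e; apply/matrixP => ? ?; rewrite !ord1 e mxE.
  have TE := on_line fr Ta; have [T0 fT _] := nT.
  have x0 : T *m Pi != 0 by rewrite -(line_eq0 fr) -TE.
  rewrite TE -oB (line_proj fr) andbC -mul_perp_eq0 //.
  move/eqP: fT; rewrite {1}TE -meval_lforms fB LoE !big_cons big_nil mulr1.
  rewrite mevalZ !mevalM !meval_lform !mulf_eq0 (negPf c0) /= !orbb => /eqP e.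
  by apply/eqP/matrixP => ? ?; rewrite !ord1 e mxE.
have N1 : (1 < N)%N by lia.
have N3 : (3 < N)%N by lia.
have tot X : mult X (T :: nseq (3 * d.+1 + 2) O) =
    (mult X [:: O; O; O] + mult X (T :: nseq (3 * d + 2) O))%N.
  by rewrite !multE !mulnDr mulnA [(_ * 3)%N]mulnC !mulnS; nia.
have [X|X nX|h [g' [hh hg' gE]]] := noether f_homog secO hg.
- by rewrite !inE !orbb => /eqP ->.
- have [dl br] := branch_ex N nX; exists N, dl; split=> //.
  by apply: dvdp_trans (cg _ _ nX br); rewrite dvdp_exp2l // tot leq_addr.
apply: IH; first lia.
exists g'; split=> //.
  by move=> [q qE]; apply: mg; exists (h + lform a * q); rewrite gE qE; ring.
move=> X dl nX br.
apply: (dvd_pev_section (congr1 (pev _) (esym gE)) br (contact_form f_homog secO nX br _ _)) => //.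
  rewrite -tot; apply: leq_trans (count_size _ _) _ => /=.
  by rewrite size_nseq; lia.
by rewrite -tot; apply: cg.
Qed.

(** Half of Abel's theorem: [realized_mul] and [realized_foldr] move [k] times
    the nine points to the [k]-fold sum and copies of [O], where
    [realized_inflection] applies.  The form is first multiplied by the
    inflectional tangent, as the additions need a point [O] to start from. *)
Lemma realized_torsion N k s : size s = 9%N ->
  (forall P, P \in s -> nonsingular_point f P) -> (9 * k + 20 <= N)%N ->
  realized N (3 * k) (flatten (nseq k s)) ->
  (cubic_mul f O k (foldr (cubic_add f O) O s) == O)%MS.
Proof.
move=> s9 hs kN [g [hg mg cg]]; set S := foldr _ _ _.
have [_ lO] := O_infl; have [O0 fO _] := nsO.
have [a secO] := line_section_linear lO O0 O0 O0.
have N1 : (1 < N)%N by lia.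
have N3 : (3 < N)%N by lia.
have r1 : realized N (3 * k).+1 (O :: flatten (nseq k s) ++ [:: O; O]).
  exists (lform a * g); split; first exact: (dhomogM (dhomog_lform a) hg).
    by move=> /(multiple_lform_mul secO).
  move=> X dl nX br; rewrite [pev _ _]rmorphM.
  have -> : mult X (O :: flatten (nseq k s) ++ [:: O; O]) =
      (mult X [:: O; O; O] + mult X (flatten (nseq k s)))%N.
    by rewrite !multE; lia.
  rewrite exprD dvdp_mul //; first exact/ord0_dvd/(contact_form f_homog secO nX br).
  exact: cg.
have nS : nonsingular_point f S by apply: nonsingular_foldr.
have nkS P : P \in nseq k S -> nonsingular_point f P by rewrite mem_nseq => /andP[_ /eqP ->].
have := @realized_mul N _ s k [:: O; O] _ hs _ r1; rewrite s9 => /(_ isT)/= r2.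
have {r2}r2 := realized_foldr nkS _ (r2 _).
have foldE : foldr (cubic_add f O) O (nseq k S) = cubic_mul f O k S.
  by rewrite /cubic_mul; elim: (k) => //= m ->.
rewrite foldE size_nseq in r2.
apply: (@realized_inflection N (3 * k)); [|lia|].
  by rewrite -foldE; apply: nonsingular_foldr.
apply: eq_realized (r2 _ _).
- by move=> X; rewrite !multE !mulnDr; lia.
- by rewrite size_cat !size_nseq /=; lia.
- by rewrite /=; lia.
Qed.

End GroupLaw.

(** * Dimensions of spaces of forms *)

Lemma irreducible_no_line (F : closedFieldType) (f : {mpoly F[3]}) :
  irreducible_cubic f ->
  forall B : 'M[F]_(2, 3), \rank B = 2%N -> f \mPo lforms B != 0.
Proof.
move=> [fh [_ irr]] B rB; apply/eqP => fB.
have unit_homog d (q : {mpoly F[3]}) : q \is d.-homog -> q \is a GRing.unit -> d = 0%N.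
  move=> hq; rewrite /GRing.unit /= /mpoly_unit => /andP[/eqP qE qu].
  apply/esym/(@dhomog_uniq _ _ mdeg q) => //; last first.
    by rewrite qE -[_%:MP]mulr1 mul_mpolyC; apply: dhomogZ; exact: dhomog1.
  by apply: contraTneq qu => ->; rewrite mcoeff0 unitr0.
have f0 : f != 0.
  apply/eqP => f0; have := irr 0 0; rewrite mulr0 orbb => /(_ f0).
  by move=> /(unit_homog 1%N) => /(_ (dhomog0 _ _ _)).
have [a [v [Pi fr]]] := frame_ex rB.
have [w wa|q fE] := @lform_dvd F _ a f (frame_normal_neq0 fr).
  by rewrite (on_line fr wa) -meval_lforms fB meval0.
have hl := dhomog_lform a.
case/orP: (irr _ _ fE) => [/(unit_homog _ _ hl) //|qu].
have : q = (q@_0%MM)%:MP.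
  by move: qu; rewrite /GRing.unit /= /mpoly_unit => /andP[/eqP].
move=> qE; have : f \is 1.-homog.
  by rewrite fE qE mulrC mul_mpolyC; apply: dhomogZ.
by move/(dhomog_uniq f0 fh).
Qed.

Lemma lfun_linE (F : fieldType) (U V : vectType F) (g : U -> V) :
  linear g -> linfun g =1 g.
Proof.
move=> lin; pose g' : {linear U -> V} := HB.pack g (GRing.isLinear.Build F U V _ g lin).
exact: (lfunE g').
Qed.

Section HomogeneousMaps.
Variable F : closedFieldType.

(** Forms of degree [d] are a vector space of their own type; [dproj] makes
    multiplication and substitution into linear maps between such spaces. *)
Definition dproj n d (p : {mpoly F[n]}) : dhomog n F d := DHomog (pihomogP mdeg d p).

Lemma dproj_linear n d : linear (@dproj n d).
Proof. by move=> c p q; apply/val_inj; rewrite /= linearP. Qed.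

Lemma dprojE n d (p : {mpoly F[n]}) : p \is d.-homog -> dproj d p = p :> {mpoly F[n]}.
Proof. by move=> hp; rewrite /= pihomog_dE. Qed.

Definition dmul n d e (g : {mpoly F[n.+1]}) : 'Hom(dhomog n.+1 F d, dhomog n.+1 F e) :=
  linfun (fun p => dproj e (g * mpoly_of_dhomog p)).

Lemma dmulE n d e (g : {mpoly F[n.+1]}) (p : dhomog n.+1 F d) :
  dmul d e g p = dproj e (g * mpoly_of_dhomog p).
Proof.
rewrite lfun_linE // => c q r; rewrite /= mulrDr -scalerAr.
exact: dproj_linear.
Qed.

Lemma dmul_val n d e c (g : {mpoly F[n.+1]}) (p : dhomog n.+1 F d) :
  g \is c.-homog -> (c + d = e)%N -> dmul d e g p = g * p :> {mpoly F[n.+1]}.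
Proof.
move=> hg <-; rewrite dmulE dprojE //; exact: dhomogM hg (dhomog_is_dhomog p).
Qed.

Lemma dmul_inj n d e c (g : {mpoly F[n.+1]}) : g != 0 ->
  g \is c.-homog -> (c + d = e)%N -> lker (dmul d e g) == 0%VS.
Proof.
move=> g0 hg cde; apply/lker0P => p q /(congr1 (@mpoly_of_dhomog _ _ _)).
by rewrite !(dmul_val _ hg cde) => /(mulfI g0)/val_inj.
Qed.

Lemma dim_limg_dmul n d e c (g : {mpoly F[n.+1]}) (U : {vspace dhomog n.+1 F d}) :
  g != 0 -> g \is c.-homog -> (c + d = e)%N -> \dim (dmul d e g @: U) = \dim U.
Proof.
move=> g0 hg cde; rewrite limg_dim_eq //.
by have /eqP -> := dmul_inj g0 hg cde; rewrite capv0.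
Qed.

Definition dsub m n d (B : 'M[F]_(m.+1, n.+1)) : 'Hom(dhomog n.+1 F d, dhomog m.+1 F d) :=
  linfun (fun p => dproj d (mpoly_of_dhomog p \mPo lforms B)).

Lemma dsub_val m n d (B : 'M[F]_(m.+1, n.+1)) (p : dhomog n.+1 F d) :
  dsub d B p = mpoly_of_dhomog p \mPo lforms B :> {mpoly F[m.+1]}.
Proof.
rewrite lfun_linE => [|c q r]; first exact/dprojE/dhomog_lforms/dhomog_is_dhomog.
by rewrite -dproj_linear -comp_mpolyZ -comp_mpolyD.
Qed.

Lemma dim_dhomog n d : \dim {:dhomog n.+1 F d} = 'C(d + n, d).
Proof. exact: dimvf. Qed.

Lemma dim_dhomog3 d : \dim {:dhomog 3 F d} = 'C(d.+2, 2).
Proof. by rewrite dim_dhomog addn2 -bin_sub ?addn2 ?subSn ?subnn //; lia. Qed.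

Lemma dim_dhomog2 d : \dim {:dhomog 2 F d} = d.+1.
Proof. by rewrite dim_dhomog addn1 binSn. Qed.
End HomogeneousMaps.

Lemma dim_cap_lb (F : fieldType) (V : vectType F) (U W : {vspace V}) :
  (\dim U + \dim W <= \dim (U :&: W) + \dim {:V})%N.
Proof. by rewrite -dimv_sum_cap addnC leq_add2l dimvS ?subvf. Qed.

Lemma dim_preim_lb (F : fieldType) (V V' : vectType F) (U : {vspace V})
    (phi : 'Hom(V, V')) (I : {vspace V'}) :
  (\dim U + \dim I <= \dim (U :&: phi @^-1: I) + \dim {:V'})%N.
Proof.
have lim (W : {vspace V}) := limg_ker_dim phi W.
have kE : (U :&: phi @^-1: I :&: lker phi = U :&: lker phi)%VS.
  have kI : (lker phi <= phi @^-1: I)%VS by rewrite -lpreim0 lpreimS ?sub0v.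
  by rewrite -capvA (capv_idPr kI).
have iE : (phi @: U :&: I <= phi @: (U :&: phi @^-1: I))%VS.
  apply/subvP => y /memv_capP[/memv_imgP[x xU ->] xI].
  by rewrite memv_img // memv_cap xU -memv_preim.
have := lim U; have := lim (U :&: phi @^-1: I)%VS; rewrite kE => <- <-.
have := dim_cap_lb (phi @: U) I; have := dimvS iE; lia.
Qed.

Section CurveBound.
Variables (F : closedFieldType) (f : {mpoly F[3]}).
Hypothesis f_homog : f \is 3.-homog.
Hypothesis no_line : forall B : 'M[F]_(2, 3), \rank B = 2%N -> f \mPo lforms B != 0.

Lemma cubic_neq0 : f != 0.
Proof.
have := @no_line (pid_mx 2); rewrite rank_pid_mx // => /(_ erefl).
by apply: contraNneq => ->; rewrite comp_mpoly0.
Qed.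

Section Bound.
Variables (P : {mpoly F[3]} -> Prop) (k : nat).
Variables (B : 'M[F]_(2, 3)) (a : 'cV[F]_3) (v : 'rV[F]_3) (Pi : 'M[F]_(3, 2)).
Hypothesis fr : frame B a v Pi.
Hypothesis rB : \rank B = 2%N.
Hypothesis k_gt0 : (0 < k)%N.
Hypothesis P_lin : forall c p q, P p -> P q -> P (c *: p + q).
Hypothesis P_f : forall h, P (f * h).
Hypothesis P_div : forall g h g', g = f * h + lform a * g' -> P g -> P g'.
Hypothesis P_base : forall g, g \is (3 * k).-homog -> P g -> multiple f g.

(** [P] stands for vanishing on the curve to prescribed orders at points off the
    line [a].  By [noether_mod], the elements of [U] that are divisible by [f]
    on the line have the form [f * h + lform a * g'] with [P g'], and [g'] has
    smaller degree.  They have codimension at most 3 in [U], since [f] cuts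
    three points on the line.  In degree [3 k] only multiples of [f] are left. *)
Lemma curve_bound e d (U : {vspace dhomog 3 F d}) : d = (3 * k + e)%N ->
  (forall p, p \in U -> P (mpoly_of_dhomog p)) ->
  (\dim U <= 3 * e + 'C((d - 3).+2, 2))%N.
Proof.
elim: e d U => [|e IH] d U dE UP.
  rewrite addn0 in dE; rewrite muln0 add0n -(dim_dhomog3 F).
  have d3 : (3 + (d - 3) = d)%N by lia.
  rewrite -(dim_limg_dmul fullv cubic_neq0 f_homog d3); apply: dimvS.
  apply/subvP => p pU.
  have hp : val p \is (3 * k).-homog by rewrite -dE; exact: dhomog_is_dhomog.
  have [q pE] := P_base hp (UP _ pU).
  have -> : p = dmul (d - 3) d f (dproj (d - 3) q).
    apply/val_inj; rewrite /= (dmul_val _ f_homog d3) /= -(pihomogM _ f_homog); last by lia.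
    by rewrite -pE pihomog_dE //; exact: dhomog_is_dhomog.
  by rewrite memv_img ?memvf.
have d3 : (3 + (d - 3) = d)%N by lia.
have d1 : (1 + d.-1 = d)%N by lia.
have d4 : (4 + (d.-1 - 3) = d)%N by lia.
have d31 : (1 + (d.-1 - 3) = d - 3)%N by lia.
have d33 : (3 + (d.-1 - 3) = d.-1)%N by lia.
have d0 : (0 < d)%N by lia.
have fB0 := no_line rB; have fBh := dhomog_lforms B f_homog.
pose I := (dmul (d - 3) d (f \mPo lforms B) @: fullv)%VS.
have dimI : \dim I = (d - 2)%N.
  by rewrite (dim_limg_dmul _ fB0 fBh d3) dim_dhomog2; lia.
have h3 := dim_preim_lb U (dsub d B) I.
set U' := (U :&: _)%VS in h3; rewrite dimI dim_dhomog2 in h3.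
have [W WP] : exists W : {vspace dhomog 3 F d.-1}, forall p, p \in W <-> P (mpoly_of_dhomog p).
  apply: (vspace_of_submod (A := fun p => P (mpoly_of_dhomog p))) => [|c p q].
    by rewrite /= -(mulr0 f); apply: P_f.
  exact: P_lin.
have dimW : (\dim W <= 3 * e + 'C((d.-1 - 3).+2, 2))%N.
  by apply: IH; [lia | move=> p /WP].
have l0 : lform a != 0 := lform_neq0 (frame_normal_neq0 fr).
have lh := dhomog_lform a.
pose A1 := (dmul (d - 3) d f @: fullv)%VS.
pose A2 := (dmul d.-1 d (lform a) @: W)%VS.
have U'A : (U' <= A1 + A2)%VS.
  apply/subvP => p /memv_capP[pU]; rewrite -memv_preim => /memv_imgP[h0 _ pB].
  have hp : val p \is d.-1.+1.-homog.
    by rewrite prednK //; exact: dhomog_is_dhomog.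
  have [|h [g' [hh hg' pE]]] := noether_mod f_homog (h0 := val h0) fr hp.
    have := congr1 (@mpoly_of_dhomog _ _ _) pB.
    by rewrite (dmul_val _ fBh d3) dsub_val.
  rewrite prednK // in hh.
  apply/memv_addP; exists (dmul (d - 3) d f (DHomog hh)); first by rewrite memv_img ?memvf.
  exists (dmul d.-1 d (lform a) (DHomog hg')).
    by rewrite memv_img //; apply/WP; apply: P_div pE (UP _ pU).
  by apply/val_inj; rewrite /= (dmul_val _ f_homog d3) (dmul_val _ lh d1).
have A12 : ('C((d.-1 - 3).+2, 2) <= \dim (A1 :&: A2))%N.
  have fl0 : f * lform a != 0 by rewrite mulf_neq0 // cubic_neq0.
  have flh : f * lform a \is 4.-homog := dhomogM f_homog lh.
  rewrite -(dim_dhomog3 F) -(dim_limg_dmul fullv fl0 flh d4); apply: dimvS.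
  apply/subvP => _ /memv_imgP[q _ ->]; rewrite memv_cap; apply/andP; split.
    have -> : dmul (d.-1 - 3) d (f * lform a) q =
        dmul (d - 3) d f (dmul (d.-1 - 3) (d - 3) (lform a) q).
      by apply/val_inj; rewrite /= (dmul_val _ flh d4) (dmul_val _ f_homog d3) (dmul_val _ lh d31) mulrA.
    by rewrite memv_img ?memvf.
  have -> : dmul (d.-1 - 3) d (f * lform a) q =
      dmul d.-1 d (lform a) (dmul (d.-1 - 3) d.-1 f q).
    by apply/val_inj; rewrite /= (dmul_val _ flh d4) (dmul_val _ lh d1) (dmul_val _ f_homog d33) mulrCA mulrA.
  by rewrite memv_img //; apply/WP; rewrite (dmul_val _ f_homog d33); apply: P_f.
have := dimvS U'A; have := dimv_sum_cap A1 A2.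
rewrite (dim_limg_dmul _ cubic_neq0 f_homog d3) (dim_limg_dmul _ l0 lh d1) dim_dhomog3.
move: h3 dimW A12 d1 d3; move: (\dim U) (\dim U') (\dim (A1 + A2)) (\dim (A1 :&: A2)) (\dim W).
move: 'C(_, _) 'C(_, _) => c1 c2 x1 x2 x3 x4 x5.
by rewrite mulnS; lia.
Qed.
End Bound.
End CurveBound.

Section GenericArc.
Variables (F : closedFieldType) (n : nat) (X : 'rV[F]_n).

(** The arc at [X] in the direction of the generic point: its coefficients are
    polynomials in the direction. *)
Definition genarc : {mpoly F[n]} -> {poly {mpoly F[n]}} :=
  mmap (polyC \o @mpolyC n F) (fun i => ((X 0 i)%:MP)%:P + 'X * ('X_i)%:P).

HB.instance Definition _ := GRing.RMorphism.copy genarc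
  (mmap (polyC \o @mpolyC n F) (fun i => ((X 0 i)%:MP)%:P + 'X * ('X_i)%:P)).

Lemma pev_genarc dl p : pev (arc X dl) p = (map_poly (pev dl) (genarc p)).['X].
Proof.
apply/esym; apply: (mpoly_rmorph_ext (phi := horner_eval 'X \o map_poly (pev dl) \o genarc)
  (psi := pev (arc X dl))) => [c|i] /=; rewrite /horner_eval /genarc.
  by rewrite mmapC /= map_polyC hornerC /= !pevC.
rewrite mmapX mmap1U rmorphD rmorphM /= map_polyX !map_polyC !hornerE /=.
by rewrite pevC !pevX !mxE.
Qed.

Lemma coef_genarc w p j :
  (pev (arc X (map_mx polyC w)) p)`_j = ((genarc p)`_j).@[w 0].
Proof.
rewrite pev_genarc -[RHS](coef_map (meval (w 0))) /=; congr (polyseq _)`_j.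
rewrite (eq_map_poly (pev_const w)) (map_poly_comp polyC (meval (w 0))).
exact: comp_polyXr.
Qed.

(** The first [k] coefficients vanish in the generic direction, and every arc is
    a specialization of the generic one. *)
Lemma arc_generic p k :
  (forall w, 'X^k %| pev (arc X (map_mx polyC w)) p) ->
  forall dl, 'X^k %| pev (arc X dl) p.
Proof.
move=> h dl; rewrite pev_genarc horner_coef.
have G0 j : (j < k)%N -> (genarc p)`_j = 0.
  move=> jk; apply: mpoly_eq_eval => w; rewrite meval0 -coef_genarc.
  exact: (elimT (dvdXn_coef _ _) (h w)).
elim/big_ind : _ => [|x y hx hy|j _]; first exact: dvdp0.
  exact: dvdp_add.
rewrite coef_map /=; have [jk|kj] := ltnP j k; first by rewrite G0 // rmorph0 mul0r dvdp0.
by rewrite dvdp_mull // dvdp_exp2l.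
Qed.

(** The initial form of [f] at [X] is a nonzero linear form, and the initial form
    of a product is the product of the initial forms. *)
Lemma arc_div (f p : {mpoly F[n]}) k : f.@[X 0] = 0 -> grad f X != 0 ->
  (forall dl, 'X^(k.+1) %| pev (arc X dl) (f * p)) ->
  forall dl, 'X^k %| pev (arc X dl) p.
Proof.
move=> fX gX h; suff H j : (j <= k)%N -> forall dl, 'X^j %| pev (arc X dl) p by exact: H.
elim: j => [_ dl|j IH jk]; first by rewrite expr0 dvd1p.
have pj dl : 'X^j %| pev (arc X dl) p by apply: IH; exact: ltnW.
suff G0 : (genarc p)`_j = 0.
  apply: arc_generic => w; apply/dvdXn_coef => i; rewrite ltnS leq_eqVlt => /orP[/eqP ->|ij].
    by rewrite coef_genarc G0 meval0.
  exact: (elimT (dvdXn_coef _ _) (pj (map_mx polyC w))).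
apply: (mulfI (lform_neq0 gX)); rewrite mulr0; apply: mpoly_eq_eval => w.
rewrite mevalM meval_lform meval0 -coef_genarc.
have := h (map_mx polyC w); have /dvdpP[s ps] := pj (map_mx polyC w).
have [r fE] := pev_arc1 f X (map_mx polyC w).
rewrite rmorphM /= ps fE fX add0r at0_const expr2 -mulrA -mulrDr.
set u := (_ + _); rewrite coefMXn ltnn subnn.
have -> : 'X * u * (s * 'X^j) = 'X^(j.+1) * (u * s) by rewrite exprS; ring.
move/(dvdp_trans (dvdp_exp2l 'X (_ : (j.+2 <= k.+1)%N))) => /(_ jk).
rewrite [in X in X %| _]exprSr dvdp_mul2l ?expf_neq0 ?polyX_eq0 // dvdX_horner.
by rewrite /u !hornerE ?mul0r ?addr0 horner_coef0 => /eqP.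
Qed.
End GenericArc.

Section Lines.
Variable F : closedFieldType.

Lemma frame_of_form (a : 'cV[F]_3) : a != 0 -> exists B v Pi, frame B a v Pi.
Proof.
move=> /complete_col[A Au Aa].
pose A' : 'M[F]_(3, 1 + 2) := A; pose M : 'M[F]_(1 + 2, 3) := invmx A.
have AE : A = row_mx (lsubmx A') (rsubmx A') by rewrite hsubmxK.
have aE : lsubmx A' = a.
  by rewrite -Aa; apply/colP => i; rewrite !mxE; congr (A _ _); apply/val_inj.
have ME : invmx A = col_mx (usubmx M) (dsubmx M) by rewrite vsubmxK.
have e1 : row_mx a (rsubmx A') *m col_mx (usubmx M) (dsubmx M) = 1%:M.
  by rewrite -ME -aE -AE mulmxV.
have : col_mx (usubmx M) (dsubmx M) *m row_mx a (rsubmx A') = 1%:M.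
  by rewrite -ME -aE -AE; exact: (mulVmx Au).
rewrite mul_row_col in e1; rewrite mul_col_row scalar_mx_block.
case/eq_block_mx => va vP Ba BP.
by exists (dsubmx M), (usubmx M), (rsubmx A'); split=> //; rewrite addrC.
Qed.

Lemma frame_rank B a v Pi : frame (F := F) B a v Pi -> \rank B = 2%N.
Proof. by move=> /line_free /eqP. Qed.

(** The product of the linear forms with coefficients [s i] is nonzero at some point. *)
Lemma avoiding_form n m (s : 'I_m -> 'rV[F]_n) : (forall i, s i != 0) ->
  exists a : 'cV[F]_n, forall i, s i *m a != 0.
Proof.
move=> s0; have : \prod_i lform (s i)^T != 0.
  apply/prodf_neq0 => i _; apply: lform_neq0.
  by rewrite -trmx0 (inj_eq trmx_inj).
move=> ne0.
have [w] : exists w, (\prod_i lform (s i)^T).@[w] != 0.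
  apply: contrapT => h; case/eqP: ne0; apply: mpoly_eq0_eval => w.
  by apply/eqP; apply: contrapT => hw; apply: h; exists w; apply/negP.
rewrite rmorph_prod /= => /prodf_neq0 h; exists (\col_j w j) => i.
apply: contraNneq (h i isT) => /matrixP/(_ 0 0); rewrite mxE [RHS]mxE => e.
rewrite -(@meval_eq _ _ ((\row_j w j) 0)) => [|j]; last by rewrite mxE.
rewrite meval_lform mxE; apply/eqP/(etrans _ e).
by apply: eq_bigr => j _; rewrite !mxE mulrC.
Qed.
End Lines.

Section LowerBound.
Variable F : closedFieldType.

(** All coordinates but the [i]-th vanish at the [i]-th coordinate point. *)
Lemma dvd_pev_mono n (i : 'I_n) k d (q : {mpoly F[n]}) dl : q \is d.-homog ->
  (forall m, m \in msupp q -> (m i + k <= d)%N) ->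
  'X^k %| pev (arc (delta_mx 0 i) dl) q.
Proof.
move=> /dhomogP hq hm; rewrite [q]mpolyE rmorph_sum big_seq /=.
elim/big_ind : _ => [|x y hx hy|m mq]; [exact: dvdp0 | exact: dvdp_add |].
rewrite pevZ dvdp_mull // pevXm (bigD1 i) //= dvdp_mull //.
apply: (@dvdp_trans _ ('X^(\sum_(j | j != i) m j))).
  have dE : d = mdeg m by exact/esym/hq.
  by rewrite dvdp_exp2l //; have := hm m mq; rewrite dE mdegE (bigD1 i) //= leq_add2l.
rewrite -prodrXr; elim/big_ind2 : _ => [|x y z t xy zt|j ji]; first exact: dvdpp.
  exact: dvdp_mul.
by rewrite !mxE eqxx (negPf ji) add0r exprMn dvdp_mulr.
Qed.

Lemma dim_bigcap_lb (V : vectType F) (I : Type) (s : seq I) (L : I -> {vspace V}) c :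
  (forall i, (\dim {:V} <= \dim (L i) + c)%N) ->
  (\dim {:V} <= \dim (\bigcap_(i <- s) L i) + size s * c)%N.
Proof.
move=> h; elim: s => [|i s IH]; first by rewrite big_nil mul0n addn0.
have aux (t x b y e : nat) : (t <= x + c -> t <= b + e -> x + b <= y + t ->
  t <= y + (c + e))%N by lia.
by rewrite big_cons mulSn; apply: aux (h i) IH (dim_cap_lb _ _).
Qed.

(** The complementary monomials are those divisible by [x_0 ^ (d - k + 1)], which
    are as many as the monomials of degree [k - 1]. *)
Lemma mono_space_dim d k : (0 < k)%N -> (k <= d)%N ->
  exists C : {vspace dhomog 3 F d},
   (forall q, q \in C -> forall m : 'X_{1..3}, m \in msupp (mpoly_of_dhomog q) -> (m 0%R + k <= d)%N) /\
   ('C(d.+2, 2) <= \dim C + 'C(k.+1, 2))%N.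
Proof.
move=> k0 kd.
have [C Cp] : exists C : {vspace dhomog 3 F d}, forall q, q \in C <->
    forall m : 'X_{1..3}, (d < m 0%R + k)%N -> (mpoly_of_dhomog q)@_m = 0.
  apply: (vspace_of_submod (A := fun q => forall m : 'X_{1..3}, (d < m 0%R + k)%N ->
     (mpoly_of_dhomog q)@_m = 0)) => [m _|c p q hp hq m dm]; first by rewrite mcoeff0.
  by rewrite mcoeffD mcoeffZ hp // hq // mulr0 addr0.
exists C; split=> [q /Cp h m|].
  by rewrite leqNgt mcoeff_msupp; apply: contra => /h ->.
pose X0 : {mpoly F[3]} := 'X_0 ^+ (d - k.-1).
have hX0 : X0 \is (d - k.-1).-homog.
  have h1 : ('X_0 : {mpoly F[3]}) \is 1.-homog by rewrite dhomogX; apply/eqP/mdeg1.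
  by have := dhomogMn (d - k.-1) h1; rewrite mul1n.
have dk : (d - k.-1 + k.-1 = d)%N by lia.
have X00 : X0 != 0.
  apply: expf_neq0; apply/eqP => /(congr1 (mcoeff U_(0)))/eqP.
  by rewrite mcoeffXU mcoeff0 oner_eq0.
pose E := (dmul k.-1 d X0 @: fullv)%VS.
have dimE : \dim E = 'C(k.+1, 2).
  by rewrite (dim_limg_dmul _ X00 hX0 dk) dim_dhomog3 prednK.
have CE : (C + E = fullv)%VS.
  apply: subv_anti; rewrite subvf /=; apply/subvP => q _.
  have hq := dhomog_is_dhomog q; have /dhomogP hm := hq.
  pose q1 := \sum_(m <- msupp (val q) | (m 0%R + k <= d)%N) (val q)@_m *: 'X_[m].
  pose q2 := \sum_(m <- msupp (val q) | ~~ (m 0%R + k <= d)%N)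
     (val q)@_m *: 'X_[m - U_(0) *+ (d - k.-1)].
  have qE : val q = q1 + X0 * q2.
    rewrite [LHS]mpolyE (bigID (fun m : 'X_{1..3} => (m 0%R + k <= d)%N)) /=; congr (_ + _).
    rewrite mulr_sumr; apply: eq_bigr => m dm; rewrite -scalerAr /X0 mpolyXn -mpolyXD.
    rewrite addmC submK //; apply/mnm_lepP => i; rewrite mulmnE mnm1E.
    by case: eqP => [<-|]; rewrite ?mul0n // mul1n; move: dm; rewrite -ltnNge; lia.
  have hq1 : q1 \is d.-homog.
    rewrite /q1 big_seq_cond rpred_sum // => m /andP[mq _]; apply: rpredZ.
    by rewrite dhomogX; apply/eqP; exact: hm.
  have hq2 : X0 * q2 = X0 * pihomog mdeg k.-1 q2.
    have -> : X0 * q2 = val q - q1 by rewrite qE addrC addKr.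
    rewrite -(pihomog_dE (d := d) (mf := mdeg) (p := val q - q1)); last exact: rpredB.
    have -> : val q - q1 = X0 * q2 by rewrite qE addrC addKr.
    rewrite (pihomogM _ hX0) ?leq_subr //; congr (_ * pihomog _ _ _); lia.
  apply/memv_addP; exists (DHomog hq1).
    apply/Cp => m dm /=; rewrite raddf_sum /= big1 // => m' dm'.
    rewrite mcoeffZ mcoeffX; case: eqP => [e|]; last by rewrite mulr0.
    by move: dm'; rewrite e leqNgt dm.
  exists (dmul k.-1 d X0 (dproj k.-1 q2)); first by rewrite memv_img ?memvf.
  by apply/val_inj; rewrite /= (dmul_val _ hX0 dk) /= -hq2 -qE.
by have := dimv_sum_cap C E; rewrite CE dimE dim_dhomog3; lia.
Qed.

(** After a change of coordinates each of the points is a coordinate point, where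
    [mono_space_dim] counts the conditions. *)
Lemma mult_lower_bound d k n (s : 'I_n -> 'rV[F]_3) (U : {vspace dhomog 3 F d}) :
  (forall i, s i != 0) -> (k <= d)%N ->
  (forall q, (forall i dl, 'X^k %| pev (arc (s i) dl) (mpoly_of_dhomog q)) -> q \in U) ->
  ('C(d.+2, 2) <= \dim U + n * 'C(k.+1, 2))%N.
Proof.
move=> s0 kd hU; have [k0|k0] := posnP k.
  rewrite -(dim_dhomog3 F); apply: leq_trans (leq_addr _ _); apply: dimvS.
  by apply/subvP => q _; apply: hU => i dl; rewrite k0 expr0 dvd1p.
have [C [Cm Cdim]] := mono_space_dim k0 kd.
have /choice[M Mp] i : exists M : 'M[F]_3, M \in unitmx /\ row 0 M = s i.
  have [|A Au As] := @complete_col F _ (s i)^T.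
    by rewrite -trmx0 (inj_eq trmx_inj).
  by exists A^T; rewrite unitmx_tr -tr_col As trmxK.
pose L i := (dsub d (M i) @^-1: C)%VS.
have dimL i : (\dim {:dhomog 3 F d} <= \dim (L i) + 'C(k.+1, 2))%N.
  have := dim_preim_lb fullv (dsub d (M i)) C; rewrite capfv dim_dhomog3 addnC leq_add2r.
  by move=> CL; apply: leq_trans Cdim _; rewrite leq_add2r.
have := dim_bigcap_lb (enum 'I_n) dimL; rewrite size_enum_ord dim_dhomog3.
move=> /leq_trans; apply; rewrite leq_add2r; apply: dimvS; apply/subvP => q qL.
apply: hU => i dl; have [Mu Ms] := Mp i.
have : q \in L i.
  by apply: (subvP _ _ qL); rewrite (big_rem i) ?mem_enum //= capvSl.
rewrite -memv_preim => /Cm qm.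
have -> : mpoly_of_dhomog q = (mpoly_of_dhomog q \mPo lforms (M i)) \mPo lforms (invmx (M i)).
  by apply: mpoly_eq_eval => w; rewrite !meval_lforms mulmxKV.
rewrite pev_lforms /arc mulmxDl -map_mxM -scalemxAl -/(arc _ _) -Ms rowE.
rewrite -mulmxA mulmxV // mulmx1; apply: (@dvd_pev_mono _ 0 k d).
  exact/dhomog_lforms/dhomog_is_dhomog.
by move=> m; rewrite -(dsub_val (M i) q); apply: qm.
Qed.
End LowerBound.

(** * The postulation of nine multiple points *)

Lemma double_bin2 n : (2 * 'C(n.+1, 2) = n.+1 * n)%N.
Proof. by rewrite -[X in (_ = _ * X)%N]bin1 -mul_bin_diag. Qed.

(** The bound obtained by restriction to the cubic, and the number of forms
    diminished by the number of conditions, are the same. *)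
Lemma postulation_arith k e :
  (3 * k * e + 'C(e.+2, 2) + 9 * 'C(k.+1, 2) = 'C((3 * k + e).+2, 2))%N.
Proof.
have := double_bin2 e.+1; have := double_bin2 k; have := double_bin2 (3 * k + e).+1.
by move: 'C(_, _) 'C(_, _) 'C(_, _) => x y z; nia.
Qed.

Section NinePoints.
Variables (F : closedFieldType) (f : {mpoly F[3]}) (O : 'rV[F]_3) (a : 'M[F]_(9, 3)).
Hypothesis f_irr : irreducible_cubic f.
Hypothesis O_infl : inflection_point f O.
Hypothesis a_ns : forall i, nonsingular_point f (row i a).
Hypothesis a_inj : forall i j, (row i a == row j a)%MS -> i = j.
Hypothesis a_tors : ~ cubic_torsion f O (cubic_sum f O (fun i => row i a)).

Let f_homog : f \is 3.-homog. Proof. by case: f_irr. Qed.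
Let no_line := irreducible_no_line f_irr.

(** Multiplicity at least [k] at each of the nine points. *)
Definition vanishing k (p : {mpoly F[3]}) :=
  forall i dl, 'X^k %| pev (arc (row i a) dl) p.

Let pts := [seq row i a | i <- enum 'I_9].

Lemma cubic_sumE : cubic_sum f O (fun i => row i a) = foldr (cubic_add f O) O pts.
Proof.
rewrite /cubic_sum /pts unlock /= /reducebig /index_enum -enumT.
by elim: (enum 'I_9) => //= i s ->.
Qed.

(** Otherwise [realized_torsion] would make the sum of the nine points torsion. *)
Lemma torsion_multiple N k g : (0 < k)%N -> (9 * k + 20 <= N)%N ->
  g \is (3 * k).-homog -> cut f N (flatten (nseq k pts)) g -> multiple f g.
Proof.
move=> k0 kN hg cg; apply: contrapT => mg; apply: a_tors; exists k => //.
rewrite cubic_sumE; apply: (realized_torsion f_homog no_line O_infl (N := N)) => //.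
- by rewrite size_map size_enum_ord.
- by move=> P /mapP[i _ ->].
- by exists g.
Qed.

Lemma mult_pts X i : (row i a == X)%MS -> mult X pts = 1%N.
Proof.
move=> iX; rewrite /mult count_map.
rewrite (eq_count (a2 := pred1 i)) => [|j /=].
  by rewrite count_uniq_mem ?enum_uniq // mem_enum.
apply/idP/eqP => [jX|->//]; apply: a_inj; apply/eqmxP.
exact: eqmx_trans (eqmxP jX) (eqmx_sym (eqmxP iX)).
Qed.

Lemma mult_flatten X k : mult X (flatten (nseq k pts)) = (k * mult X pts)%N.
Proof. by elim: k => //= k IH; rewrite mult_cat IH mulSn. Qed.

Lemma mult_flatten_le X k : (mult X (flatten (nseq k pts)) <= 9 * k)%N.
Proof.
apply: leq_trans (count_size _ _) _.
by rewrite size_flatten /shape map_nseq sumn_nseq size_map size_enum_ord.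
Qed.

Lemma mult_ptsP X : (exists i, (row i a == X)%MS) \/ mult X pts = 0%N.
Proof.
have [|h] := boolP (has (fun Y => (Y == X)%MS) pts).
  by case/hasP => _ /mapP[i _ ->] iX; left; exists i.
by right; apply/eqP; rewrite -leqn0 leqNgt -has_count.
Qed.

Lemma vanishing_cut N k d g : g \is d.-homog -> vanishing k g ->
  cut f N (flatten (nseq k pts)) g.
Proof.
move=> hg vg X dl _ _; rewrite mult_flatten.
case: (mult_ptsP X) => [[i iX]|->]; last by rewrite muln0 expr0 dvd1p.
rewrite (mult_pts iX) muln1; have /proj_eqP : (row i a == X)%MS by [].
have [i0 _ _] := a_ns i; move=> /(_ i0)[c c0 ->].
have -> : arc (c *: row i a) dl = c%:P *: arc (row i a) (c^-1%:P *: dl).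
  rewrite /arc map_mxZ scalerDr; congr (_ + _).
  by rewrite !scalerA mulrAC -polyCM mulfV // mul1r.
by rewrite (pev_homog_scale _ _ hg) dvdp_mull.
Qed.

(** The line used for [curve_bound] avoids the nine points, so that dividing by
    its linear form does not change the orders at these points. *)
Lemma cut_upper_bound N k e d (U : {vspace dhomog 3 F d}) : (0 < k)%N ->
  (9 * k + 20 <= N)%N -> d = (3 * k + e)%N ->
  (forall p, p \in U -> cut f N (flatten (nseq k pts)) (mpoly_of_dhomog p)) ->
  (\dim U <= 3 * e + 'C((d - 3).+2, 2))%N.
Proof.
move=> k0 kN dE UP.
have [al al0] : exists al : 'cV[F]_3, forall i, row i a *m al != 0.
  by apply: avoiding_form => i; case: (a_ns i).
have aln0 : al != 0 by apply: contraNneq (al0 0) => ->; rewrite mulmx0.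
have [B [v [Pi fr]]] := frame_of_form aln0.
have lN X : (mult X (flatten (nseq k pts)) <= N)%N.
  by apply: leq_trans (mult_flatten_le X k) _; lia.
apply: (curve_bound f_homog no_line (P := cut f N (flatten (nseq k pts)))
   fr (frame_rank fr) k0 _ _ _ _ dE) => //.
- move=> c p q cp cq X dl nX br; rewrite rmorphD /= pevZ dvdp_add //.
    by rewrite dvdp_mull //; apply: cp.
  exact: cq.
- move=> h X dl nX [_ fN]; rewrite rmorphM dvdp_mulr //.
  by apply: dvdp_trans fN; rewrite dvdp_exp2l.
- move=> g h g' gE cg X dl nX br; have [[i iX]|X0] := mult_ptsP X; last first.
    by rewrite mult_flatten X0 muln0 expr0 dvd1p.
  apply: (dvd_pev_section (r := 0) (congr1 (pev _) (esym gE)) br) => //.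
    apply: ord0_unit; rewrite pev_at0 at0_arc meval_lform.
    have [i0 _ _] := a_ns i.
    have /proj_eqP : (row i a == X)%MS by [].
    move=> /(_ i0)[c c0 ->]; rewrite -scalemxAl mxE mulf_neq0 //.
    apply: contraNneq (al0 i) => h0; apply/eqP/matrixP => ? ?.
    by rewrite !ord1 h0 mxE.
  - exact: lN.
  - exact: cg.
- by move=> g hg cg; apply: torsion_multiple cg.
Qed.

Lemma multiple_lform al g : al != 0 -> multiple f (lform al * g) -> multiple f g.
Proof.
move=> al0 [h e]; have [B [v [Pi fr]]] := frame_of_form al0.
have [h' hE] := line_prime fr (no_line (frame_rank fr)) (esym e); exists h'.
by apply: (mulfI (lform_neq0 al0)); rewrite e hE; ring.
Qed.

Lemma vanishing_div k p : vanishing k.+1 (f * p) -> vanishing k p.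
Proof.
move=> h i dl; have [_ fa ga] := (nonsingularP f _).1 (a_ns i).
exact: (arc_div fa ga (h i)).
Qed.

Lemma homog_multiple d p : p \is d.-homog -> multiple f p ->
  if (3 <= d)%N then exists2 q, q \is (d - 3).-homog & p = f * q else p = 0.
Proof.
move=> hp [q pE]; case: ifP => d3.
  exists (pihomog mdeg (d - 3) q); first exact: pihomogP.
  by rewrite -(pihomogM _ f_homog d3) -pE pihomog_dE.
by rewrite -(pihomog_dE hp) pE (pihomogM_small _ f_homog) // ltnNge d3.
Qed.

(** Powers of a linear form raise the degree to [3 k], whence [p] is a multiple of
    [f] by [torsion_multiple]; dividing by [f] lowers [d] by 3 and [k] by 1. *)
Lemma vanishing_small k d p : (d < 3 * k)%N -> p \is d.-homog -> vanishing k p -> p = 0.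
Proof.
elim: k d p => [|k IH] d p dk hp vp; first by rewrite muln0 in dk.
have mp : multiple f p.
  pose al : 'cV[F]_3 := delta_mx 0 0.
  have al0 : al != 0.
    by apply/eqP => /matrixP/(_ 0 0)/eqP; rewrite !mxE !eqxx oner_eq0.
  have : multiple f (lform al ^+ (3 * k.+1 - d) * p).
    apply: (@torsion_multiple (9 * k.+1 + 20) k.+1) => //.
      have := dhomogM (dhomogMn (3 * k.+1 - d) (dhomog_lform al)) hp.
      by rewrite mul1n subnK // ltnW.
    move=> X dl nX br; rewrite rmorphM dvdp_mull //.
    exact: (vanishing_cut hp vp nX br).
  elim: (3 * k.+1 - d)%N => [|j IHj]; first by rewrite expr0 mul1r.
  by rewrite exprS -mulrA => /(multiple_lform al0)/IHj.
have := homog_multiple hp mp; case: ifP => // d3 [q hq pE].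
rewrite pE (IH (d - 3)%N q) ?mulr0 //; first by rewrite mulnS in dk; lia.
by apply: vanishing_div; rewrite -pE.
Qed.

(** The multiples of [f] in [U] are counted by induction on [k], and the
    restrictions of [U] to the cubic by [cut_upper_bound], applied to the sum of
    [U] and the space of all multiples of [f]. *)
Lemma vanishing_upper k e d (U : {vspace dhomog 3 F d}) : d = (3 * k + e)%N ->
  (forall p, p \in U -> vanishing k (mpoly_of_dhomog p)) ->
  (\dim U <= 3 * k * e + 'C(e.+2, 2))%N.
Proof.
elim: k d U => [|k IH] d U dE UP.
  have -> : e = d by rewrite dE.
  by rewrite muln0 mul0n add0n -(dim_dhomog3 F) dimvS // subvf.
have d3 : (3 + (d - 3) = d)%N by lia.
pose A := (dmul (d - 3) d f @: fullv)%VS.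
have f0 := cubic_neq0 no_line.
have dimA : \dim A = 'C((d - 3).+2, 2).
  by rewrite (dim_limg_dmul _ f0 f_homog d3) dim_dhomog3.
have UA : (\dim (U + A) <= 3 * e + 'C((d - 3).+2, 2))%N.
  apply: (@cut_upper_bound (9 * k.+1 + 20) k.+1) => // p /memv_addP[u uU [_ /memv_imgP[h _ ->] ->]].
  move=> X dl nX br; rewrite [mpoly_of_dhomog _]raddfD rmorphD /= dvdp_add //.
    exact: (vanishing_cut (dhomog_is_dhomog u) (UP _ uU) nX br).
  rewrite (dmul_val _ f_homog d3) rmorphM dvdp_mulr //; case: br => _ fN.
  apply: dvdp_trans fN; rewrite dvdp_exp2l //; apply: leq_trans (mult_flatten_le X k.+1) _.
  exact: leq_addr.
pose W := (dmul (d - 3) d f @^-1: U)%VS.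
have dimW : (\dim W <= 3 * k * e + 'C(e.+2, 2))%N.
  apply: IH => [|q]; first by rewrite dE mulnS; lia.
  rewrite -memv_preim => /UP; rewrite (dmul_val _ f_homog d3).
  exact: vanishing_div.
have UAW : (U :&: A <= dmul (d - 3) d f @: W)%VS.
  apply/subvP => p /memv_capP[pU /memv_imgP[q _ pE]].
  by rewrite pE memv_img // -memv_preim -pE.
have := dimvS UAW; rewrite (dim_limg_dmul _ f0 f_homog d3) => /leq_trans/(_ dimW).
have := dimv_sum_cap U A; rewrite dimA; move: UA.
move: (\dim (U + A)) (\dim (U :&: A)) (\dim U) 'C(_, _) 'C(_, _) => x y z c1 c2.
by rewrite mulnS mulnDl; lia.
Qed.

(** Upper and lower bound meet: [k] times the nine points impose independent
    conditions on forms of degree [d >= 3 k]. *)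
Lemma dim_vanishing d k (U : {vspace dhomog 3 F d}) : (k <= d)%N ->
  (forall p, p \in U <-> vanishing k (mpoly_of_dhomog p)) ->
  \dim U = if (3 * k <= d)%N then (3 * k * (d - 3 * k) + 'C((d - 3 * k).+2, 2))%N
    else 0%N.
Proof.
move=> kd Up; case: leqP => [kd3|dk]; last first.
  apply/eqP; rewrite dimv_eq0 -subv0; apply/subvP => p /Up vp.
  rewrite memv0; apply/eqP/val_inj; exact: (vanishing_small dk (dhomog_is_dhomog p) vp).
have dE : d = (3 * k + (d - 3 * k))%N by lia.
apply/eqP; rewrite eqn_leq (vanishing_upper dE) => [|p /Up //].
have low := @mult_lower_bound F d k 9 (fun i => row i a) U
  (fun i => let: And3 i0 _ _ := a_ns i in i0) kd (fun q vq => (Up q).2 vq).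
rewrite -(leq_add2r (9 * 'C(k.+1, 2))); apply: leq_trans low.
by rewrite postulation_arith -dE.
Qed.

End NinePoints.

(** * Invariants and plane curves with multiple points *)

Section Monomials.
Variable F : closedFieldType.

Lemma mcoeff_sum_msupp (R : nzRingType) n (p : {mpoly R[n]}) (c : 'X_{1..n} -> R) m :
  (\sum_(m' <- msupp p) (c m' * p@_m') *: 'X_[m'])@_m = c m * p@_m.
Proof.
rewrite raddf_sum /=; have [mp|mp] := boolP (m \in msupp p).
  rewrite (bigD1_seq m) ?msupp_uniq //= mcoeffZ mcoeffX eqxx mulr1.
  rewrite big1 ?addr0 // => m' mm'; by rewrite mcoeffZ mcoeffX (negPf mm') mulr0.
rewrite (memN_msupp_eq0 mp) mulr0 big_seq big1 // => m' mp'.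
by rewrite mcoeffZ mcoeffX; case: eqP => [e|]; [rewrite -e mp' in mp | rewrite mulr0].
Qed.

Lemma mcoeff_diag n (c : 'I_n -> F) (p : {mpoly F[n]}) m :
  (p \mPo [tuple c k *: 'X_k | k < n])@_m = (\prod_k c k ^+ m k) * p@_m.
Proof.
rewrite comp_mpolyEX -(mcoeff_sum_msupp p (fun m => \prod_k c k ^+ m k)).
congr (_@__); apply: eq_bigr => m' _; rewrite comp_mpolyX mulrC -scalerA; congr (_ *: _).
rewrite mpolyXE_id -scaler_prod; apply: eq_bigr => k _.
by rewrite tnth_mktuple exprZn.
Qed.

Lemma msupp_mdeg n d (q : {mpoly F[n]}) m : q \is d.-homog -> m \in msupp q -> mdeg m = d.
Proof. by move=> /dhomogP h /h. Qed.

(** The converse of [dvd_pev_mono].  In a direction [z] with zero [i]-th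
    coordinate, the coefficient of [t ^ (d - j)] is the value at [z] of the part
    of [q] that has degree [j] in the [i]-th variable. *)
Lemma mono_of_dvd n (i : 'I_n) k d (q : {mpoly F[n]}) : q \is d.-homog ->
  (forall z : 'rV_n, 'X^k %| pev (arc (delta_mx 0 i) (map_mx polyC z)) q) ->
  forall m, m \in msupp q -> (m i + k <= d)%N.
Proof.
move=> hq hz m mq; rewrite leqNgt; apply/negP => dm.
have mid (m' : 'X_{1..n}) : m' \in msupp q -> (m' i <= d)%N.
  by move=> /(msupp_mdeg hq) <-; rewrite mdegE (bigD1 i) //= leq_addr.
move: (mq); rewrite mcoeff_msupp => /eqP; apply.
have := mcoeff_sum_msupp q (fun m' => (m' i == m i)%:R) m; rewrite eqxx mul1r => <-.
rewrite [X in X@__](_ : _ = 0) ?mcoeff0 //; apply: mpoly_eq_eval => z; rewrite meval0.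
pose z' : 'rV[F]_n := \row_j (if j == i then 0 else z 0 j).
have := elimT (dvdXn_coef _ _) (hz z') (d - m i)%N; rewrite ltn_subLR ?mid // => /(_ dm).
rewrite [q in pev _ q]mpolyE rmorph_sum coef_sum rmorph_sum /= => e.
transitivity (z 0 i ^+ m i * 0); last by rewrite mulr0.
rewrite -[X in _ = _ * X]e mulr_sumr; apply: eq_big_seq => m' mq'.
rewrite mevalZ mevalX pevZ pevXm coefCM.
have -> : \prod_j arc (delta_mx 0 i) (map_mx polyC z') 0 j ^+ m' j =
    (\prod_(j | j != i) z 0 j ^+ m' j)%:P * 'X^(d - m' i).
  rewrite (bigD1 i) //= !mxE !eqxx mulr0 addr0 expr1n mul1r.
  have -> : (d - m' i = \sum_(j | j != i) m' j)%N.
    by rewrite -(msupp_mdeg hq mq') mdegE (bigD1 i) //= addKn.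
  rewrite -prodrXr rmorph_prod -big_split /=; apply: eq_bigr => j ji.
  by rewrite !mxE eqxx (negPf ji) add0r exprMn mulrC rmorphXn.
rewrite coefCM coefXn (bigD1 i) //=.
have -> : (d - m i == d - m' i)%N = (m' i == m i).
  by have := mid _ mq; have := mid _ mq'; lia.
by case: eqP => [->|_]; rewrite ?mul0r ?mulr0 //; ring.
Qed.

Lemma pihomog_lforms m n (M : 'M[F]_(m, n)) d p :
  pihomog mdeg d (p \mPo lforms M) = pihomog mdeg d p \mPo lforms M.
Proof.
have -> : pihomog mdeg d p = \sum_(mu <- msupp p) p@_mu *: pihomog mdeg d 'X_[mu].
  by rewrite {1}[p]mpolyE raddf_sum /=; apply: eq_bigr => mu _; rewrite linearZ.
rewrite comp_mpolyEX !raddf_sum /=; apply: eq_bigr => mu _.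
rewrite !linearZ /= pihomogX; congr (_ *: _).
have h : 'X_[mu] \mPo lforms M \is (mdeg mu).-homog.
  by apply: dhomog_lforms; rewrite dhomogX.
case: eqP => [e|e]; first by rewrite pihomog_dE // -e.
by rewrite comp_mpoly0 (pihomog_ne0 (d := mdeg mu)) //; apply/eqP.
Qed.
End Monomials.

Section Dehomogenization.
Variable F : closedFieldType.
Implicit Types (mu : 'X_{1..9 + 9}) (m : 'X_{1..9}) (Q : {mpoly F[9]}) (p : {mpoly F[9 + 9]}).

Definition ypart mu : 'X_{1..9} := [multinom mu (rshift 9 i) | i < 9].

Definition weight mu i : nat := (mu (lshift 9 i) + mu (rshift 9 i))%N.

(** [m] is the exponent in the [y_i], and powers of the [x_i] fill up the weight
    [w] in each pair of variables. *)
Definition homog_mono w m : 'X_{1..9 + 9} :=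
  [multinom match split k with inl i => (w - m i)%N | inr i => m i end | k < 9 + 9].

Lemma homog_mono_l w m i : homog_mono w m (lshift 9 i) = (w - m i)%N.
Proof. by rewrite mnmE (unsplitK (inl i)). Qed.

Lemma homog_mono_r w m i : homog_mono w m (rshift 9 i) = m i.
Proof. by rewrite mnmE (unsplitK (inr i)). Qed.

Lemma split_ord_ind (n1 n2 : nat) (P : 'I_(n1 + n2) -> Prop) :
  (forall i, P (lshift n2 i)) -> (forall i, P (rshift n1 i)) -> forall k, P k.
Proof. by move=> hl hr k; rewrite -(splitK k); case: (split k). Qed.

Lemma homog_monoK w mu : (forall i, weight mu i = w) ->
  homog_mono w (ypart mu) = mu.
Proof.
move=> hw; apply/mnmP; apply: split_ord_ind => i.
  by rewrite homog_mono_l mnmE -(hw i) addnK.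
by rewrite homog_mono_r mnmE.
Qed.

Lemma ypartK w m : ypart (homog_mono w m) = m.
Proof. by apply/mnmP => i; rewrite mnmE homog_mono_r. Qed.

Lemma weight_homog_mono w m i : (m i <= w)%N -> weight (homog_mono w m) i = w.
Proof. by move=> mw; rewrite /weight homog_mono_l homog_mono_r subnK. Qed.

Lemma mdeg_weight mu : mdeg mu = (\sum_i weight mu i)%N.
Proof. by rewrite mdegE big_split_ord /= -big_split. Qed.

Definition dehom_vars : (9 + 9).-tuple {mpoly F[9]} :=
  [tuple match split k with inl _ => 1 | inr i => 'X_i end | k < 9 + 9].

Lemma tnth_dehom_l i : tnth dehom_vars (lshift 9 i) = 1.
Proof. by rewrite tnth_mktuple (unsplitK (inl i)). Qed.

Lemma tnth_dehom_r i : tnth dehom_vars (rshift 9 i) = 'X_i.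
Proof. by rewrite tnth_mktuple (unsplitK (inr i)). Qed.

Lemma dehomX mu : 'X_[mu] \mPo dehom_vars = 'X_[ypart mu].
Proof.
rewrite comp_mpolyX big_split_ord /= big1 => [|i _]; last by rewrite tnth_dehom_l expr1n.
rewrite mul1r mpolyXE_id; apply: eq_bigr => i _.
by rewrite tnth_dehom_r mnmE.
Qed.

Lemma msupp_dehom p m : m \in msupp (p \mPo dehom_vars) ->
  exists2 mu, mu \in msupp p & m = ypart mu.
Proof.
rewrite comp_mpolyEX => h; apply: contrapT => nex; move: h.
rewrite mcoeff_msupp raddf_sum big_seq big1 ?eqxx //= => mu mup.
rewrite dehomX mcoeffZ mcoeffX; case: eqP => [e|]; last by rewrite mulr0.
by case: nex; exists mu.
Qed.

(** Inserting [y_i / x_i] for the variables and clearing the denominators by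
    the [w]-th power of the product of all [x_i].  The sum runs over all
    monomials of degree less than [K] to make it linear in [Q]. *)
Definition hom w K Q : {mpoly F[9 + 9]} :=
  \sum_(m : 'X_{1..9 < K}) Q@_m *: 'X_[homog_mono w m].

Lemma hom_linear w K : linear (hom w K).
Proof.
move=> c p q; rewrite /hom scaler_sumr -big_split; apply: eq_bigr => m _.
by rewrite mcoeffD mcoeffZ scalerDl scalerA.
Qed.

HB.instance Definition _ w K :=
  GRing.isLinear.Build F {mpoly F[9]} {mpoly F[9 + 9]} _ (hom w K) (@hom_linear w K).

Lemma homX w K m : (mdeg m < K)%N -> hom w K 'X_[m] = 'X_[homog_mono w m].
Proof.
move=> mK; rewrite /hom (bigD1 (BMultinom mK)) //= mcoeffX eqxx scale1r.
rewrite big1 ?addr0 // => m' mm'; rewrite mcoeffX.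
by rewrite eq_sym -[(val m') == m]/(m' == BMultinom mK) (negPf mm') scale0r.
Qed.

Lemma homE w K Q : (msize Q <= K)%N ->
  hom w K Q = \sum_(m <- msupp Q) Q@_m *: 'X_[homog_mono w m].
Proof.
move=> QK; rewrite [Q in LHS]mpolyE raddf_sum; apply: eq_big_seq => m mQ.
rewrite /= linearZ /= homX //; apply: leq_trans QK; exact: msize_mdeg_lt.
Qed.

Lemma homK w K Q : (msize Q <= K)%N -> hom w K Q \mPo dehom_vars = Q.
Proof.
move=> QK; rewrite homE // raddf_sum [RHS]mpolyE; apply: eq_bigr => m _.
by rewrite /= comp_mpolyZ dehomX ypartK.
Qed.

Lemma dehomK w K p : (9 * w < K)%N ->
  (forall mu i, mu \in msupp p -> weight mu i = w) ->
  hom w K (p \mPo dehom_vars) = p.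
Proof.
move=> wK pw; rewrite comp_mpolyEX raddf_sum [RHS]mpolyE.
apply: eq_big_seq => mu /pw mw; rewrite /= linearZ /= dehomX homX ?homog_monoK //.
apply: leq_ltn_trans wK; have <- : (\sum_(i < 9) w = 9 * w)%N by rewrite sum_nat_const card_ord.
by rewrite mdegE; apply: leq_sum => i _; rewrite mnmE -(mw i) leq_addl.
Qed.

(** The condition under which the subtractions in [homog_mono] are exact, i.e.,
    clearing denominators in [hom] leaves a polynomial. *)
Definition bounded w Q := forall m i, m \in msupp Q -> (m i <= w)%N.

Lemma dhomog_hom w K Q : (msize Q <= K)%N -> bounded w Q ->
  hom w K Q \is (9 * w).-homog.
Proof.
move=> QK Qw; rewrite homE // big_seq rpred_sum // => m mQ; apply: rpredZ.
rewrite dhomogX; apply/eqP; rewrite -[LHS]/(mdeg _) mdeg_weight.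
under eq_bigr do rewrite weight_homog_mono ?Qw //.
by rewrite sum_nat_const card_ord.
Qed.

Lemma meval_hom w K Q (x y : 'rV[F]_9) : (msize Q <= K)%N -> bounded w Q ->
  (forall i, x 0 i != 0) ->
  (hom w K Q).@[(row_mx x y) 0] =
  \prod_i x 0 i ^+ w * Q.@[(\row_i (y 0 i / x 0 i)) 0].
Proof.
move=> QK Qw x0; rewrite homE // raddf_sum [Q in RHS]mpolyE raddf_sum mulr_sumr.
apply: eq_big_seq => m mQ; rewrite /= !mevalZ !mevalX mulrCA; congr (_ * _).
rewrite big_split_ord /= -2!big_split /=; apply: eq_bigr => i _.
rewrite row_mxEl row_mxEr homog_mono_l homog_mono_r mxE exprMn exprVn.
have xm : x 0 i ^+ m i != 0 by rewrite expf_neq0.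
by rewrite -{2}(subnK (Qw _ i mQ)) exprD -mulrA (mulrCA (x 0 i ^+ m i)) mulfV ?mulr1.
Qed.

(** Multiplied by the product of all [x_i], both sides agree everywhere. *)
Lemma mpoly_eq_generic p q :
  (forall x y : 'rV[F]_9, (forall i, x 0 i != 0) ->
    p.@[(row_mx x y) 0] = q.@[(row_mx x y) 0]) -> p = q.
Proof.
move=> pq; have X0 : \prod_(i < 9) ('X_(lshift 9 i) : {mpoly F[9 + 9]}) != 0.
  apply/prodf_neq0 => i _; apply/eqP => /(congr1 (mcoeff U_(lshift 9 i)))/eqP.
  by rewrite mcoeffXU eqxx mcoeff0 oner_eq0.
apply: (mulfI X0); apply: mpoly_eq_eval => v; rewrite !mevalM rmorph_prod /=.
have [/prodf_neq0 h|/negPn/eqP ->] := boolP (\prod_(i < 9) ('X_(lshift 9 i)).@[v 0] != 0);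
  last by rewrite !mul0r.
rewrite -[v]hsubmxK pq // => i; have := h i isT.
by rewrite mevalXU !mxE.
Qed.
End Dehomogenization.

Section Action.
Variable F : closedFieldType.
Implicit Types (p : {mpoly F[9 + 9]}).

Lemma meval_act (s t : 'rV[F]_9) p (x y : 'rV[F]_9) :
  (act (s, t) p).@[(row_mx x y) 0] =
  p.@[(row_mx (\row_i (t 0 i * x 0 i)) (\row_i (t 0 i * (s 0 i * x 0 i + y 0 i)))) 0].
Proof.
rewrite /act comp_mpoly_meval; apply: meval_eq.
apply: split_ord_ind => i; rewrite tnth_mktuple /act_var.
  by rewrite (unsplitK (inl i)) mevalZ mevalXU !row_mxEl mxE.
rewrite (unsplitK (inr i)) mevalZ mevalD mevalZ !mevalXU !row_mxEl !row_mxEr !mxE //.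
Qed.

Variable a : 'M[F]_(9, 3).

(** The torus element with entries [l] and [l^-1] at [i] and [j] multiplies the
    monomial by [l] to the difference of the two weights. *)
Lemma invariant_weight p mu i j : invariant (G a) p -> mu \in msupp p ->
  weight mu i = weight mu j.
Proof.
move=> inv mup; have [->//|ij] := eqVneq i j.
suff : 'X^(weight mu i) - 'X^(weight mu j) = 0 :> {poly F}.
  move/eqP; rewrite subr_eq0 => /eqP /(congr1 (fun q => size (polyseq q))).
  by rewrite !size_polyXn => -[].
apply: poly_eq0_eval => l l0.
pose t : 'rV[F]_9 := \row_k (if k == i then l else if k == j then l^-1 else 1).
have Gt : G a (0, t).
  split; first by rewrite /G1 /= mul0mx.
  split=> [k|] /=.
    by rewrite mxE; case: ifP => _ //; case: ifP; rewrite ?invr_eq0 ?oner_eq0.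
  rewrite (bigD1 i) //= (bigD1 j) 1?eq_sym //= !mxE eqxx [j == i]eq_sym (negPf ij) eqxx.
  rewrite big1 ?mulr1 ?mulfV // => k /andP[ki kj].
  by rewrite mxE (negPf ki) (negPf kj).
have := congr1 (mcoeff mu) (inv _ Gt).
have -> : act (0, t) p = p \mPo [tuple (match split k with inl i => t 0 i | inr i => t 0 i end) *: 'X_k | k < 9 + 9].
  rewrite /act; congr (p \mPo _); apply: eq_from_tnth; apply: split_ord_ind => k.
    by rewrite !tnth_mktuple /act_var (unsplitK (inl k)).
  by rewrite !tnth_mktuple /act_var (unsplitK (inr k)) /= [X in X *: xvar _ _]mxE scale0r add0r.
rewrite mcoeff_diag; move: mup; rewrite mcoeff_msupp => p0.
rewrite -[X in _ = X]mul1r => /(mulIf p0).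
rewrite big_split_ord /= -big_split /=.
under eq_bigr => k _ do rewrite (unsplitK (inl k)) (unsplitK (inr k)) -exprD -/(weight mu k).
rewrite (bigD1 i) //= (bigD1 j) 1?eq_sym //= !mxE eqxx [j == i]eq_sym (negPf ij) eqxx.
rewrite big1 ?mulr1 => [|k /andP[ki kj]]; last by rewrite mxE (negPf ki) (negPf kj) expr1n.
rewrite !hornerE exprVn => e.
apply/eqP; rewrite subr_eq0; apply/eqP.
by apply: (mulIf (_ : l ^- weight mu j != 0)); rewrite ?invr_eq0 ?expf_neq0 // e mulfV ?expf_neq0.
Qed.

Lemma homog_invariant_weight n p : p \is n.-homog -> invariant (G a) p ->
  forall mu i, mu \in msupp p -> (9 * weight mu i = n)%N.
Proof.
move=> hp inv mu i mup; rewrite -(msupp_mdeg hp mup) mdeg_weight.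
rewrite (eq_bigr (fun=> weight mu i)) => [|j _]; last exact: invariant_weight inv mup.
by rewrite sum_nat_const card_ord.
Qed.

(** Where all [x_i] are [1], elements of [G1] translate the [y_i]. *)
Lemma invariant_translation p (s z : 'rV[F]_9) : invariant (G a) p -> s *m a = 0 ->
  (p \mPo dehom_vars F).@[(z + s) 0] = (p \mPo dehom_vars F).@[z 0].
Proof.
move=> inv sa.
have dehomE (w : 'rV_9) : (p \mPo dehom_vars F).@[w 0] = p.@[(row_mx (const_mx 1) w) 0].
  rewrite comp_mpoly_meval; apply: meval_eq; apply: split_ord_ind => i.
    by rewrite tnth_dehom_l meval1 row_mxEl mxE.
  by rewrite tnth_dehom_r mevalXU row_mxEr.
have Gs : G a (s, const_mx 1).
  split=> //; split=> [i|] /=; first by rewrite mxE oner_eq0.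
  by rewrite big1 // => i _; rewrite mxE.
rewrite !dehomE -[in RHS](inv _ Gs) meval_act.
by congr (p.@[(row_mx _ _) 0]); apply/rowP => i; rewrite !mxE ?mul1r ?mulr1 // addrC.
Qed.

Lemma hom_invariant w K Q : (msize Q <= K)%N -> bounded w Q ->
  (forall s z : 'rV[F]_9, s *m a = 0 -> Q.@[(z + s) 0] = Q.@[z 0]) ->
  invariant (G a) (hom w K Q).
Proof.
move=> QK Qw Qs [s t] [/= sa [t0 t1]].
apply: mpoly_eq_generic => x y x0; rewrite meval_act !meval_hom //; last first.
  by move=> i; rewrite mxE mulf_neq0.
congr (_ * _).
  under eq_bigr do rewrite mxE exprMn.
  by rewrite big_split /= prodrXl t1 expr1n mul1r.
rewrite -[RHS](Qs s _ sa); apply: meval_eq => i; rewrite !mxE.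
by field; rewrite t0 x0.
Qed.
End Action.

Section InvariantDimension.
Variables (F : closedFieldType) (a : 'M[F]_(9, 3)).

Lemma homog_invariantsP n (p : dhomog (9 + 9) F n) :
  p \in homog_invariants (G a) n <-> invariant (G a) (mpoly_of_dhomog p).
Proof. exact: (projT2 (cid (homog_invariants_subspace (G a) n))). Qed.

Lemma vanishing_subspace d k : exists U : {vspace dhomog 3 F d},
  forall p, p \in U <-> vanishing a k (mpoly_of_dhomog p).
Proof.
apply: (vspace_of_submod (A := fun p : dhomog 3 F d => vanishing a k (mpoly_of_dhomog p))).
  by move=> i dl; rewrite rmorph0 dvdp0.
move=> c p q hp hq i dl; rewrite [mpoly_of_dhomog _]/= rmorphD /= pevZ dvdp_add //.
by rewrite dvdp_mull.
Qed.

Definition vanishing_space d k := projT1 (cid (vanishing_subspace d k)).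

Lemma vanishing_spaceP d k p :
  p \in vanishing_space d k <-> vanishing a k (mpoly_of_dhomog p).
Proof. exact: (projT2 (cid (vanishing_subspace d k))). Qed.

Lemma homog_invariants_eq0 n : ~~ (9 %| n)%N -> homog_invariants (G a) n = 0%VS.
Proof.
move=> n9; apply/eqP; rewrite -subv0; apply/subvP => p /homog_invariantsP inv.
rewrite memv0; apply/eqP/val_inj/msuppnil0 => /=.
case E: (msupp _) => [//|mu s]; case/negP: n9.
have := homog_invariant_weight (dhomog_is_dhomog p) inv (mu := mu) 0.
by rewrite /= E mem_head => /(_ isT) <-; rewrite dvdn_mulr.
Qed.

Lemma section_ex : \rank a = 3%N -> exists b : 'M[F]_(3, 9), b *m a = 1%:M.
Proof. by move=> rank_a; apply/row_fullP; rewrite /row_full rank_a. Qed.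

Section Degree.
Variables (w : nat) (b : 'M[F]_(3, 9)).
Hypothesis ba : b *m a = 1%:M.
Let n := (9 * w)%N.

Lemma lforms_section (P : {mpoly F[3]}) : (P \mPo lforms a) \mPo lforms b = P.
Proof. by apply: mpoly_eq_eval => v; rewrite !meval_lforms -mulmxA ba mulmx1. Qed.

(** [z *m a *m b - z] lies in the kernel of [a]. *)
Lemma translation_descends (Q : {mpoly F[9]}) :
  (forall s z : 'rV_9, s *m a = 0 -> Q.@[(z + s) 0] = Q.@[z 0]) ->
  Q = (Q \mPo lforms b) \mPo lforms a.
Proof.
move=> Qs; apply: mpoly_eq_eval => z; rewrite !meval_lforms.
rewrite -[RHS](Qs (z - z *m a *m b)); first by rewrite addrC subrK.
by rewrite mulmxBl -!mulmxA ba mulmx1 subrr.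
Qed.

(** The map [z |-> z *m a] sends the [i]-th coordinate point to the [i]-th row of
    [a], and multiplicity at a coordinate point is visible on monomials. *)
Lemma vanishing_bounded d (P : {mpoly F[3]}) : P \is d.-homog ->
  vanishing a (d - w) P -> bounded w (P \mPo lforms a).
Proof.
move=> hP vP m i mQ; have hQ := dhomog_lforms a hP.
have := mono_of_dvd (i := i) (k := d - w) hQ _ mQ.
have h z : 'X^(d - w) %| pev (arc (delta_mx 0 i) (map_mx polyC z)) (P \mPo lforms a).
  rewrite pev_lforms /arc mulmxDl -map_mxM -rowE -scalemxAl; exact: vP.
by move=> /(_ h); lia.
Qed.

Lemma bounded_vanishing d (P : {mpoly F[3]}) : P \is d.-homog ->
  bounded w (P \mPo lforms a) -> vanishing a (d - w) P.
Proof.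
move=> hP bQ i dl.
have -> : arc (row i a) dl = arc (delta_mx 0 i) (dl *m map_mx polyC b) *m map_mx polyC a.
  by rewrite /arc mulmxDl -map_mxM -rowE -scalemxAl -mulmxA -map_mxM ba map_mx1 mulmx1.
rewrite -pev_lforms; apply: (dvd_pev_mono (d := d)); first exact: dhomog_lforms.
move=> m mQ; have := bQ m i mQ.
have : (m i <= d)%N.
  by rewrite -(msupp_mdeg (dhomog_lforms a hP) mQ) mdegE (bigD1 i) //= leq_addr.
by lia.
Qed.

Lemma msize_homog k d (q : {mpoly F[k]}) : q \is d.-homog -> (msize q <= d.+1)%N.
Proof.
move=> hq; rewrite msizeE; apply/bigmax_leqP_seq => m mq _.
by rewrite (msupp_mdeg hq mq).
Qed.

(** The outer [dproj] only serves to make the map total; on the forms of interest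
    it is the identity, by [lift_form_val]. *)
Definition lift_form d : 'Hom(dhomog 3 F d, dhomog (9 + 9) F n) :=
  linfun (fun P => dproj n (hom w n.+1 (mpoly_of_dhomog P \mPo lforms a))).

Lemma lift_form_val d P : (d <= n)%N -> P \in vanishing_space d (d - w) ->
  lift_form d P = hom w n.+1 (mpoly_of_dhomog P \mPo lforms a) :> {mpoly F[9 + 9]}.
Proof.
move=> dn /vanishing_spaceP vP; have hP := dhomog_is_dhomog P.
rewrite lfun_linE => [|c p q].
  apply: dprojE; apply: dhomog_hom; last exact: vanishing_bounded vP.
  by apply: leq_trans (msize_homog (dhomog_lforms a hP)) _.
by rewrite [mpoly_of_dhomog _]/= comp_mpolyD comp_mpolyZ linearP dproj_linear.
Qed.

Lemma dproj_vanishing d (P : {mpoly F[3]}) : bounded w (P \mPo lforms a) ->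
  dproj d P \in vanishing_space d (d - w).
Proof.
move=> Pb; apply/vanishing_spaceP; apply: bounded_vanishing; first exact: pihomogP.
rewrite /= -pihomog_lforms; move: (P \mPo lforms a) Pb => Q Qb m i mQ; apply: Qb.
move: mQ; rewrite !mcoeff_msupp; apply: contraNneq => Q0.
rewrite pihomogE raddf_sum big1 //= => m' _.
by rewrite mcoeffZ mcoeffX; case: eqP => [->|]; rewrite ?mulr0 // Q0 mul0r.
Qed.

Lemma hom_decomposition (P : {mpoly F[3]}) : bounded w (P \mPo lforms a) ->
  (msize (P \mPo lforms a) <= n.+1)%N ->
  hom w n.+1 (P \mPo lforms a) =
  \sum_(d < n.+1) mpoly_of_dhomog (lift_form d (dproj d P)).
Proof.
move=> Pb Pn; rewrite [X in hom _ _ X](pihomog_partitionE Pn) raddf_sum.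
apply: eq_bigr => d _; have dn : (d <= n)%N by rewrite -ltnS.
by rewrite (lift_form_val dn (dproj_vanishing d Pb)) /= -pihomog_lforms.
Qed.

(** The polynomial in three variables that belongs to an invariant need not be
    homogeneous; each of its components yields an invariant. *)
Lemma homog_invariants_sum :
  homog_invariants (G a) n =
  (\sum_(d < n.+1) lift_form d @: vanishing_space d (d - w))%VS.
Proof.
apply: subv_anti; apply/andP; split; last first.
  apply/subv_sumP => d _; apply/subvP => _ /memv_imgP[P PV ->].
  have dn : (d <= n)%N by rewrite -ltnS.
  apply/homog_invariantsP; rewrite (lift_form_val dn PV).
  move: PV => /vanishing_spaceP vP; have hP := dhomog_is_dhomog P.
  apply: hom_invariant; first exact: leq_trans (msize_homog (dhomog_lforms a hP)) _.
    exact: vanishing_bounded vP.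
  by move=> s z sa; rewrite !meval_lforms mulmxDl sa addr0.
apply/subvP => p /homog_invariantsP inv; have hp := dhomog_is_dhomog p.
have wt mu i : mu \in msupp (mpoly_of_dhomog p) -> weight mu i = w.
  move=> mup; have /eqP := homog_invariant_weight hp inv i mup.
  by rewrite eqn_pmul2l // => /eqP.
pose Q := mpoly_of_dhomog p \mPo dehom_vars F.
have Qb : bounded w Q.
  by move=> m i /msupp_dehom[mu mup ->]; rewrite mnmE -(wt mu i mup) leq_addl.
have Qn : (msize Q <= n.+1)%N.
  rewrite msizeE; apply/bigmax_leqP_seq => m mQ _; rewrite ltnS /n.
  have <- : (\sum_(i < 9) w = 9 * w)%N by rewrite sum_nat_const card_ord.
  by rewrite mdegE; apply: leq_sum => i _; apply: Qb.
pose P := Q \mPo lforms b.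
have QE : Q = P \mPo lforms a.
  by apply: translation_descends => s z; apply: invariant_translation inv.
have PV (d : 'I_n.+1) : dproj d P \in vanishing_space d (d - w).
  by apply: dproj_vanishing; rewrite -QE.
have -> : p = \sum_(d < n.+1) lift_form d (dproj d P).
  apply/val_inj; rewrite /= raddf_sum /=.
  rewrite -[LHS](@dehomK _ w n.+1) // -/Q QE; apply: hom_decomposition; by rewrite -QE.
by apply: memv_sumr => d _; apply: (memv_img _ (PV d)).
Qed.

Lemma hom_lforms_inj (S : {mpoly F[3]}) : (msize (S \mPo lforms a) <= n.+1)%N ->
  hom w n.+1 (S \mPo lforms a) = 0 -> S = 0.
Proof.
move=> Sn S0; rewrite -[S]lforms_section -(homK w Sn) S0.
by rewrite !comp_mpoly0.
Qed.

Lemma lift_form_indep (P : forall d : 'I_n.+1, dhomog 3 F d) :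
  (forall d, P d \in vanishing_space d (d - w)) ->
  \sum_(d < n.+1) lift_form d (P d) = 0 -> forall d, P d = 0.
Proof.
move=> PV P0; pose S := \sum_(d < n.+1) mpoly_of_dhomog (P d).
have hS : hom w n.+1 (S \mPo lforms a) = 0.
  have := congr1 (@mpoly_of_dhomog _ _ _) P0; rewrite raddf_sum /= => <-.
  rewrite /S [_ \mPo _]raddf_sum [hom _ _ _]raddf_sum; apply: eq_bigr => d _ /=.
  have dn : (d <= n)%N by rewrite -ltnS.
  by rewrite (lift_form_val dn (PV d)).
have S0 : S = 0.
  apply: hom_lforms_inj hS; rewrite /S raddf_sum; apply: leq_trans (msize_sum _ _ _) _.
  apply/bigmax_leqP => d _.
  apply: leq_trans (msize_homog (dhomog_lforms a (dhomog_is_dhomog (P d)))) _.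
  exact: ltn_ord.
move=> d; apply/val_inj => /=.
have := congr1 (pihomog mdeg d) S0; rewrite /S raddf_sum pihomog0 (bigD1 d) //=.
rewrite pihomog_dE ?dhomog_is_dhomog // big1 ?addr0 // => e ed.
by rewrite (pihomog_ne0 (d := e)) ?dhomog_is_dhomog.
Qed.

Lemma dim_homog_invariants :
  \dim (homog_invariants (G a) n) = (\sum_(d < n.+1) \dim (vanishing_space d (d - w)))%N.
Proof.
rewrite homog_invariants_sum.
have dir : directv (\sum_(d < n.+1) lift_form d @: vanishing_space d (d - w))%VS.
  apply/directv_sum_independent => us usV us0 d _.
  have [P PE] : exists P : forall d : 'I_n.+1, dhomog 3 F d, forall d : 'I_n.+1,
      P d \in vanishing_space d (d - w) /\ us d = lift_form d (P d).
    have h (e : 'I_n.+1) : exists Pe : dhomog 3 F e,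
        Pe \in vanishing_space e (e - w) /\ us e = lift_form e Pe.
      by have /memv_imgP[Pe PeV ->] := usV e isT; exists Pe.
    by exists (fun e => projT1 (cid (h e))) => e; exact: (projT2 (cid (h e))).
  have P0 : \sum_(e < n.+1) lift_form e (P e) = 0.
    by rewrite -[RHS]us0; apply: eq_bigr => e _; rewrite (PE e).2.
  by rewrite (PE d).2 (lift_form_indep (fun e => (PE e).1) P0) linear0.
rewrite (directvP dir) /=; apply: eq_bigr => d _; apply: limg_dim_eq.
apply/eqP; rewrite -subv0; apply/subvP => P /memv_capP[PV].
rewrite memv_ker => /eqP P0; rewrite memv0; apply/eqP/val_inj => /=.
have dn : (d <= n)%N by rewrite -ltnS.
apply: hom_lforms_inj; last by rewrite -(lift_form_val dn PV) P0.
exact: leq_trans (msize_homog (dhomog_lforms a (dhomog_is_dhomog P))) _.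
Qed.

End Degree.
End InvariantDimension.

(** * The Hilbert series *)

Section Counting.
Local Open Scope nat_scope.

(** The dimension given by [dim_vanishing] in degree [d = 3 k + e]. *)
Definition postulation k e := 3 * k * e + 'C(e.+2, 2).

(** The part of [invariant_count] that comes from the degrees [d = w + k] with
    [k > 0]; the excess [d - 3 k] is [w - 2 k], so [k] ends at [w./2]. *)
Definition excess_sum w := \sum_(k < w./2) postulation k.+1 (w - 2 * k.+1).

Lemma sum_bin2 w : 6 * \sum_(d < w.+1) 'C(d.+2, 2) = w.+1 * w.+2 * w.+3.
Proof.
elim: w => [|w IH]; first by rewrite big_ord_recl big_ord0.
have := double_bin2 w.+2; rewrite big_ord_recr /= mulnDr IH.
by move: 'C(_, _) => c; nia.
Qed.

Lemma sum_steps r : \sum_(k < r.+1) (r.*2 - 2 * k) = r * r.+1 /\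
  \sum_(k < r.+1) (r.*2.+1 - 2 * k) = r.+1 * r.+1.
Proof.
elim: r => [|r [IH1 IH2]]; first by split; rewrite big_ord_recl big_ord0.
have e1 (k : 'I_r.+1) : r.+1.*2 - 2 * k.+1 = r.*2 - 2 * k by lia.
have e2 (k : 'I_r.+1) : r.+1.*2.+1 - 2 * k.+1 = r.*2.+1 - 2 * k by lia.
split; rewrite big_ord_recl /= muln0 subn0.
  by under eq_bigr => k _ do rewrite e1; rewrite IH1; lia.
by under eq_bigr => k _ do rewrite e2; rewrite IH2; lia.
Qed.

(** Raising [w] by 2 and [k] by 1 keeps the excess and adds three times the
    excess to the postulation. *)
Lemma excess_sumSS w : excess_sum w.+2 =
  excess_sum w + 'C(w.+2, 2) + 3 * \sum_(k < w./2.+1) (w - 2 * k).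
Proof.
rewrite /excess_sum [w.+2./2]/=.
have e (k : 'I_(w./2.+1)) : postulation k.+1 (w.+2 - 2 * k.+1) =
    postulation k (w - 2 * k) + 3 * (w - 2 * k).
  have -> : w.+2 - 2 * k.+1 = w - 2 * k by lia.
  by rewrite /postulation mulnS mulnDl; lia.
rewrite (eq_bigr _ (fun k _ => e k)) big_split /= big_distrr /=; congr (_ + _).
rewrite big_ord_recl /= addnC; congr (_ + _).
by rewrite /postulation !muln0 mul0n subn0.
Qed.

Lemma excess_sum_closed r :
  6 * excess_sum r.*2 + (r.*2.+1 * r.*2.+2 * r.*2.+3) = 3 * (r.+1 * (6 * r * r + 3 * r + 2)) /\
  6 * excess_sum r.*2.+1 + (r.*2.+2 * r.*2.+3 * r.*2.+4) = 6 * (r.+1 * (3 * r * r + 6 * r + 4)).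
Proof.
elim: r => [|r [IH1 IH2]]; first by rewrite /excess_sum !big_ord0.
have [s1 s2] := sum_steps r.
rewrite doubleS !excess_sumSS /= uphalf_double doubleK s1 s2.
have := double_bin2 r.*2.+1; have := double_bin2 r.*2.+2.
move: IH1 IH2; move: (excess_sum _) (excess_sum _) 'C(_, _) 'C(_, _) => x y c1 c2.
rewrite -!muln2; split; nia.
Qed.

Definition invariant_count w := \sum_(d < (9 * w).+1)
  if 3 * (d - w) <= d then postulation (d - w) (d - 3 * (d - w)) else 0.

Lemma invariant_countE w : invariant_count w =
  \sum_(d < w.+1) 'C(d.+2, 2) + excess_sum w.
Proof.
rewrite /invariant_count /excess_sum.
pose v d := if 3 * (d - w) <= d then postulation (d - w) (d - 3 * (d - w)) else 0.
rewrite -[LHS](big_mkord xpredT v) (@big_cat_nat _ _ _ w.+1) //=; last by lia.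
congr (_ + _).
  rewrite big_mkord; apply: eq_bigr => d _; rewrite /v.
  have -> : d - w = 0 by have := ltn_ord d; lia.
  by rewrite muln0 leq0n /postulation mul0n subn0.
rewrite -{1}[w.+1]add0n big_addn (@big_cat_nat _ _ _ w./2) //=; last by lia.
rewrite big_mkord addnC big_nat_cond big1 => [|d /andP[/andP[wd _] _]]; last first.
  by rewrite /v; case: ifP => //; lia.
rewrite add0n; apply: eq_bigr => d _; rewrite /v.
have := ltn_ord d => dw; have -> : d + w.+1 - w = d.+1 by lia.
have -> : 3 * d.+1 <= d + w.+1 by lia.
by congr (postulation _ _); lia.
Qed.

Lemma invariant_count_even r : 2 * invariant_count r.*2 = r.+1 * (6 * r * r + 3 * r + 2).
Proof.
have [h _] := excess_sum_closed r; have s := sum_bin2 r.*2.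
rewrite invariant_countE; move: s h; move: (\sum_(_ < _) _) (excess_sum _) => x y; nia.
Qed.

Lemma invariant_count_odd r : invariant_count r.*2.+1 = r.+1 * (3 * r * r + 6 * r + 4).
Proof.
have [_ h] := excess_sum_closed r; have s := sum_bin2 r.*2.+1.
rewrite invariant_countE; move: s h; move: (\sum_(_ < _) _) (excess_sum _) => x y; nia.
Qed.
End Counting.

Section Convolution.
Variables (h : nat -> int) (n : nat).

(** The [n]-th coefficient of the product of [p] with the series [h]. *)
Definition conv (p : {poly int}) : int := \sum_(i < n.+1) p`_i * h (n - i)%N.

Lemma convD p q : conv (p + q) = conv p + conv q.
Proof. by rewrite -big_split; apply: eq_bigr => i _; rewrite coefD mulrDl. Qed.

Lemma convZ c p : conv (c *: p) = c * conv p.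
Proof. by rewrite /conv mulr_sumr; apply: eq_bigr => i _; rewrite coefZ mulrA. Qed.

Lemma convN p : conv (- p) = - conv p.
Proof. by rewrite -sumrN; apply: eq_bigr => i _; rewrite coefN mulNr. Qed.

Lemma convXn c : conv 'X^c = if (c <= n)%N then h (n - c)%N else 0.
Proof.
rewrite /conv; case: ifP => cn.
  rewrite (bigD1 (Ordinal (cn : (c < n.+1)%N))) //= coefXn eqxx mul1r big1 ?addr0 // => i ic.
  rewrite coefXn -[(val i) == c]/(i == Ordinal (cn : (c < n.+1)%N)).
  by rewrite (negPf ic) mul0r.
rewrite big1 // => i _; rewrite coefXn; case: eqP => [ic|]; last by rewrite mul0r.
by have := ltn_ord i; rewrite ic ltnS cn.
Qed.

End Convolution.

Lemma denominatorE : (1 - 'X^18) ^+ 4 =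
  'X^0 - 4 *: 'X^18 + 6 *: 'X^36 - 4 *: 'X^54 + 'X^72 :> {poly int}.
Proof. by rewrite expr0 -!mul_polyC; ring. Qed.

(** On each parity class of [w] the counts are a cubic polynomial in [w./2], whose
    fourth differences vanish; the numerator records the first four steps. *)
Lemma series_quotient_count (h : nat -> int) :
  (forall n, ~~ (9 %| n)%N -> h n = 0) -> (forall w, h (9 * w)%N = (invariant_count w)%:Z) ->
  series_quotient h
    (1 + 4 *: 'X^9 + 7 *: 'X^18 + 10 *: 'X^27 + 10 *: 'X^36 + 4 *: 'X^45)
    ((1 - 'X^18) ^+ 4).
Proof.
move=> h0 h9; split.
  by rewrite denominatorE !(coefD, coefN, coefZ, coefXn).
move=> n; pose H c : int := if (c <= n)%N then h (n - c)%N else 0.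
transitivity (H 0%N - 4 * H 18%N + 6 * H 36%N - 4 * H 54%N + H 72%N).
  by rewrite -[LHS]/(conv h n _) denominatorE !(convD, convN, convZ, convXn).
rewrite !(coefD, coefZ, coefXn, coef1).
have [/dvdnP[w nE]|n9] := boolP (9 %| n)%N; last first.
  have Hc c : (9 %| c)%N -> H c = 0.
    move=> c9; rewrite /H; case: ifP => // cn; apply: h0.
    by rewrite dvdn_subl.
  rewrite !Hc //.
  have nc c : (9 %| c)%N -> (n == c) = false by move=> c9; apply: contraNF n9 => /eqP ->.
  by rewrite !nc.
have Hw c : H (9 * c)%N = if (c <= w)%N then (invariant_count (w - c))%:Z else 0.
  by rewrite /H nE [(9 * c)%N]mulnC leq_pmul2r // -mulnBl [(_ * 9)%N]mulnC h9.
have nw c : (n == 9 * c)%N = (w == c) by rewrite nE mulnC eqn_pmul2l.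
rewrite (Hw 0%N) (Hw 2%N) (Hw 4%N) (Hw 6%N) (Hw 8%N) (nw 0%N) (nw 1%N) (nw 2%N) (nw 3%N) (nw 4%N) (nw 5%N).
have S4 r : (r.+4)%:Z = r%:Z + 4 by rewrite -addn4 PoszD.
have S3 r : (r.+3)%:Z = r%:Z + 3 by rewrite -addn3 PoszD.
have S2 r : (r.+2)%:Z = r%:Z + 2 by rewrite -addn2 PoszD.
have S1 r : (r.+1)%:Z = r%:Z + 1 by rewrite -addn1 PoszD.
rewrite -(odd_double_half w); move: (w./2) => r; case: (odd w); rewrite ?add1n ?add0n.
  have O r' := invariant_count_odd r'.
  have [O0 O1 O2 O3] : [/\ invariant_count 1 = 4, invariant_count 3 = 26,
      invariant_count 5 = 84 & invariant_count 7 = 196]%N.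
    by split; [exact: (O 0%N) | exact: (O 1%N) | exact: (O 2%N) | exact: (O 3%N)].
  have Oz r' : (invariant_count r'.*2.+1)%:Z =
      (r'%:Z + 1) * (3 * r'%:Z * r'%:Z + 6 * r'%:Z + 4).
    by rewrite O !(PoszM, PoszD) S1.
  case: r => [|[|[|[|r]]]]; rewrite ?doubleS ?double0 ?subSS ?subn0 /= ?O0 ?O1 ?O2 ?O3 //.
  have := Oz r.+4; have := Oz r.+3; have := Oz r.+2; have := Oz r.+1; have := Oz r.
  by rewrite ?doubleS /= => -> -> -> -> ->; rewrite S4 S3 S2 S1; ring.
have E r' := invariant_count_even r'.
have [E0 E1 E2 E3] : [/\ invariant_count 0 = 1, invariant_count 2 = 11,
    invariant_count 4 = 48 & invariant_count 6 = 130]%N.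
  by split; apply/eqP; rewrite -(eqn_pmul2l (ltn0Sn 1)) ?(E 0%N) ?(E 1%N) ?(E 2%N) ?(E 3%N).
have Ez r' : 2 * (invariant_count r'.*2)%:Z =
    (r'%:Z + 1) * (6 * r'%:Z * r'%:Z + 3 * r'%:Z + 2).
  by rewrite -[2]/(2%N%:Z) -PoszM E !(PoszM, PoszD) S1.
case: r => [|[|[|[|r]]]]; rewrite ?doubleS ?double0 ?subSS ?subn0 /= ?E0 ?E1 ?E2 ?E3 //.
have := Ez r.+4; have := Ez r.+3; have := Ez r.+2; have := Ez r.+1; have := Ez r.
rewrite ?doubleS /=; move: (invariant_count _)%:Z (invariant_count _)%:Z
  (invariant_count _)%:Z (invariant_count _)%:Z (invariant_count _)%:Z => x0 x1 x2 x3 x4.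
move=> e4 e3 e2 e1 e0; apply: (@mulfI int 2); first by [].
transitivity ((2 * x0) - 4 * (2 * x1) + 6 * (2 * x2) - 4 * (2 * x3) + 2 * x4); first by ring.
by rewrite e0 e1 e2 e3 e4 S4 S3 S2 S1; ring.
Qed.

Theorem proposition4p2 (R : realType) (f : {mpoly R[i][3]}) (O : 'rV[R[i]]_3)
    (a : 'M[R[i]]_(9, 3)) :
  irreducible_cubic f ->
  inflection_point f O ->
  (forall i, nonsingular_point f (row i a)) ->
  (forall i j, (row i a == row j a)%MS -> i = j) ->
  ~ cubic_torsion f O (cubic_sum f O (fun i => row i a)) ->
  \rank a = 3%N ->
  series_quotient (hilbert_series (G a))
    (1 + 4 *: 'X^9 + 7 *: 'X^18 + 10 *: 'X^27 + 10 *: 'X^36 + 4 *: 'X^45)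
    ((1 - 'X^18) ^+ 4) /\
  nice_rational (hilbert_series (G a)).
Proof.
move=> f_irr O_infl a_ns a_inj a_tors rank_a.
have [b ba] := section_ex rank_a.
suff main : series_quotient (hilbert_series (G a))
    (1 + 4 *: 'X^9 + 7 *: 'X^18 + 10 *: 'X^27 + 10 *: 'X^36 + 4 *: 'X^45)
    ((1 - 'X^18) ^+ 4).
  split=> //; exists (1 + 4 *: 'X^9 + 7 *: 'X^18 + 10 *: 'X^27 + 10 *: 'X^36 + 4 *: 'X^45).
  exists (nseq 4 18%N); split=> //.
  by rewrite (_ : \prod_(d <- _) _ = (1 - 'X^18) ^+ 4) // big_nseq -Monoid.iteropE.
apply: series_quotient_count => [n n9|w]; rewrite /hilbert_series.
  by rewrite (homog_invariants_eq0 a n9) dimv0.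
congr Posz; rewrite (dim_homog_invariants w ba); apply: eq_bigr => d _.
apply: (dim_vanishing f_irr O_infl a_ns a_inj a_tors); first exact: leq_subr.
exact: vanishing_spaceP.
Qed.
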